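(* Let $K$ be a field, let $1\le t\le n$ be integers, let $R=K[x_1,\dots,x_n]$, let $I_{n,t}\subseteq R$ be the $t$-path ideal of the path graph $P_n$, and let $\Gamma_{n,t}$ be the facet complex of $I_{n,t}$. Then for every integer $k$ with $1\le k\le \nu(\Gamma_{n,t})$, the projective dimension of $R/I_{n,t}^{[k]}$ over $R$ is $$\mathrm{pd}\left(R/I_{n,t}^{[k]}\right)=\begin{cases} n-kt+1 & \text{if } kt\le n\le k(t+1);\\[0.4em] \dfrac{2(n-d)}{t+1}-k+1 & \text{if } n\equiv d \pmod{t+1} \text{ with } 0\le d\le t-1, \text{ and } n>k(t+1);\\[0.8em] \dfrac{2(n+1)}{t+1}-k & \text{if } n\equiv t \pmod{t+1} \text{ and } n>k(t+1).\end{cases}$$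
   Context: $P_n$ is the path graph on vertex set $\{1,\dots,n\}$ with edges $\{i,i+1\}$. The $t$-path ideal $I_{n,t}$ of $P_n$ is the ideal of $R=K[x_1,\dots,x_n]$ generated by the monomials $x_ix_{i+1}\cdots x_{i+t-1}$ for $1\le i\le n-t+1$. The facet complex $\Gamma_{n,t}$ of $I_{n,t}$ is the simplicial complex whose facets are the sets $\{i,i+1,\dots,i+t-1\}$, $1\le i\le n-t+1$. A matching of a simplicial complex is a set of pairwise disjoint facets, and $\nu(\Gamma_{n,t})$ is the maximum size of a matching of $\Gamma_{n,t}$. For a squarefree monomial ideal $I$ and $k\ge1$, the $k$-th squarefree power $I^{[k]}$ is the ideal generated by the squarefree monomials in the minimal monomial generating set of $I^k$; for $I=I_{n,t}$ it is generated by the products of $k$ generators of $I_{n,t}$ with pairwise disjoint supports. *)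

(* Defs.v *)
From HB Require Import structures.
From mathcomp Require Import all_boot all_order all_algebra.
From mathcomp Require Import boolp.
From mathcomp Require Import mpoly.

Set Implicit Arguments.
Unset Strict Implicit.
Unset Printing Implicit Defensive.

Import GRing.Theory.
Local Open Scope ring_scope.
Local Open Scope quotient_scope.

Section QuotientModule.
Variables (R : pzRingType) (V : lmodType R) (W : submodClosed V).

(* A copy of W on which closure under opposite, needed by {ideal_quot _} but
   not part of the structure submodClosed, can be declared. *)
Definition submod_pred : {pred V} := fun v => v \in W.

Lemma submod_pred_closed : zmod_closed submod_pred.
Proof.
split=> [|u v uW vW]; first exact: (rpred0 W).
rewrite -[_ \in _]/(u - v \in W) -scaleN1r.
by apply: rpredD; [exact: uW | apply: rpredZ; exact: vW].
Qed.

HB.instance Definition _ :=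
  GRing.isZmodClosed.Build V submod_pred submod_pred_closed.

Definition quotient_module : Type := {ideal_quot submod_pred}.

HB.instance Definition _ := GRing.Zmodule.on quotient_module.

Definition quot_proj (v : V) : quotient_module :=
  \pi_({ideal_quot submod_pred}) v.

Lemma quot_projD : {morph quot_proj : u v / u + v}.
Proof. exact: raddfD. Qed.

Lemma quot_projP (x : quotient_module) : exists v, quot_proj v = x.
Proof. by exists (repr x); rewrite /quot_proj reprK. Qed.

Lemma quot_proj_eq (u v : V) : quot_proj u = quot_proj v <-> u - v \in W.
Proof.
rewrite -[u - v \in W]/(u - v \in submod_pred).
by rewrite Quotient.idealrBE; split => /eqP.
Qed.

Definition quot_scale (a : R) (x : quotient_module) : quotient_module :=
  quot_proj (a *: repr x).

Lemma quot_scale_proj (a : R) (v : V) :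
  quot_scale a (quot_proj v) = quot_proj (a *: v).
Proof.
apply/quot_proj_eq; rewrite -scalerBr rpredZ //.
by apply/quot_proj_eq; rewrite /quot_proj reprK.
Qed.

Lemma quot_scaleA (a b : R) (x : quotient_module) :
  quot_scale a (quot_scale b x) = quot_scale (a * b) x.
Proof. by have [v <-] := quot_projP x; rewrite !quot_scale_proj scalerA. Qed.

Lemma quot_scale1 : left_id 1 quot_scale.
Proof. by move=> x; have [v <-] := quot_projP x; rewrite quot_scale_proj scale1r. Qed.

Lemma quot_scaleDr : right_distributive quot_scale +%R.
Proof.
move=> a x y; have [u <-] := quot_projP x; have [v <-] := quot_projP y.
by rewrite -quot_projD !quot_scale_proj scalerDr quot_projD.
Qed.

Lemma quot_scaleDl (x : quotient_module) :
  {morph quot_scale^~ x : a b / a + b}.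
Proof.
by move=> a b; have [v <-] := quot_projP x; rewrite !quot_scale_proj scalerDl quot_projD.
Qed.

HB.instance Definition _ :=
  GRing.Zmodule_isLmodule.Build R quotient_module
    quot_scaleA quot_scale1 quot_scaleDr quot_scaleDl.

End QuotientModule.

Section ProjectiveDimension.
Variable R : nzRingType.

Definition surjective (A B : Type) (f : A -> B) := forall y, exists x, f x = y.

Definition projective (P : lmodType R) : Prop :=
  forall (A B : lmodType R) (g : {linear A -> B}) (f : {linear P -> B}),
    surjective g -> exists h : {linear P -> A}, forall x, g (h x) = f x.

(* ... -> P 1 -> P 0 -> M -> 0 is exact, with P i projective for all i and
   P i = 0 for i > m. *)
Definition has_projective_resolution (M : lmodType R) (m : nat) : Prop :=
  exists (P : nat -> lmodType R) (e : {linear P 0%N -> M})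
         (d : forall i, {linear P i.+1 -> P i}),
    [/\ forall i, projective (P i),
        forall i, (m < i)%N -> forall x : P i, x = 0,
        surjective e,
        forall x, e x = 0 <-> exists y, d 0%N y = x
      & forall i x, d i x = 0 <-> exists y, d i.+1 y = x].

Definition projective_dimension_is (M : lmodType R) (m : nat) : Prop :=
  has_projective_resolution M m /\
  forall l, has_projective_resolution M l -> (m <= l)%N.

End ProjectiveDimension.

Section Ideals.
Variable R : comNzRingType.

Definition ideal_gen (S : R -> Prop) : {pred R^o} := fun p =>
  `[< exists s : seq (R * R),
        (forall c, c \in s -> S c.2) /\ p = \sum_(c <- s) c.1 * c.2 >].

Lemma ideal_gen_submod_closed (S : R -> Prop) : submod_closed (ideal_gen S).
Proof.
split=> [|a u v /asboolP[s [sS ->]] /asboolP[r [rS ->]]].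
  by apply/asboolP; exists [::]; split=> //; rewrite big_nil.
apply/asboolP; exists ([seq (a * c.1, c.2) | c <- s] ++ r); split=> [c|].
  by rewrite mem_cat => /orP[/mapP[b /sS Sb ->]|/rS].
rewrite big_cat big_map /=; congr (_ + _).
by rewrite /GRing.scale /= mulr_sumr; apply: eq_bigr => c _; rewrite mulrA.
Qed.

HB.instance Definition _ (S : R -> Prop) :=
  GRing.isSubmodClosed.Build R R^o (ideal_gen S) (ideal_gen_submod_closed S).

Definition ideal_power (I : {pred R}) (k : nat) : {pred R} :=
  ideal_gen (fun p => exists f : 'I_k -> R,
    (forall i, f i \in I) /\ p = \prod_(i < k) f i).

End Ideals.

Section SquarefreePowers.
Variables (K : fieldType) (n : nat).

(* For a monomial ideal, its unique minimal set of monomial generators consists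
   of the monomials of the ideal that are minimal for divisibility. *)
Definition minimal_monomial_generator (I : {pred {mpoly K[n]}})
    (m : 'X_{1..n}) : Prop :=
  'X_[m] \in I /\
  forall m' : 'X_{1..n}, 'X_[m'] \in I -> (m' <= m)%MM -> m' = m.

Definition squarefree (m : 'X_{1..n}) : Prop := forall i, (m i <= 1)%N.

Definition squarefree_power_gens (I : {pred {mpoly K[n]}}) (k : nat)
    (p : {mpoly K[n]}) : Prop :=
  exists m : 'X_{1..n},
    [/\ minimal_monomial_generator (ideal_power I k) m,
        squarefree m & p = 'X_[m]].

Definition squarefree_power (I : {pred {mpoly K[n]}}) (k : nat) :
    submodClosed {mpoly K[n]}^o :=
  ideal_gen (squarefree_power_gens I k).

End SquarefreePowers.

Section SimplicialComplexes.
Variable T : finType.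

Definition generated_complex (S : {set {set T}}) : {set {set T}} :=
  [set A : {set T} | [exists F in S, A \subset F]].

Definition facets (D : {set {set T}}) : {set {set T}} :=
  [set F | maxset (fun A => A \in D) F].

Definition matching (D M : {set {set T}}) : bool :=
  (M \subset facets D) && trivIset M.

Definition matching_number (D : {set {set T}}) : nat :=
  \max_(M | matching D M) #|M|.

End SimplicialComplexes.

(* Vertices are numbered from 0. *)
Definition path_facets (n t : nat) : {set {set 'I_n}} :=
  [set [set j : 'I_n | (i <= j < i + t)%N] | i : 'I_n & (i + t <= n)%N].

Definition path_complex (n t : nat) : {set {set 'I_n}} :=
  generated_complex (path_facets n t).

Definition path_ideal (K : fieldType) (n t : nat) : {pred {mpoly K[n]}} :=
  ideal_gen (fun p => exists2 F, F \in path_facets n t & p = \prod_(j in F) 'X_j).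
Arguments path_ideal K n t : clear implicits.

(* Main.v *)
(* Write A(N,k) for the ideal of the monomials whose support contains k disjoint
   runs of t consecutive vertices below N, so that A(n,k) is the k-th squarefree
   power.

   Upper bound.  Splitting according to whether the last run ends at N gives
   A(N,k) = mu A(N-t,k-1) + A(N-1,k), where mu is the product of the last t
   variables; with v = N-t-1, the colon ideal that governs the intersection is
   B = A(v,k) + x_v A(v,k-1).  The two Mayer-Vietoris sequences
     0 -> B -> A(N-t,k-1) + A(N-1,k) -> A(N,k) -> 0
     0 -> A(v,k) -> A(v,k-1) + A(v,k) -> B -> 0
   bound the projective dimension by induction, and the formula of the theorem
   solves the resulting recursion.

   Lower bound.  Over the polynomial ring the Koszul complex of distinct variables
   is acyclic in positive degrees, hence so is its tensor product with a projective
   module, and a resolution of M of length l kills the Koszul homology of M above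
   degree l.  In R/I we exhibit the cycle
     w = u * prod_i (a_i e_(b_i) - b_i e_(a_i)) * e_C,
   where the (a_i, b_i) are the two ends of blocks of t+1 consecutive vertices.
   Let b be in C and let A consist of all a_i and of C without b.  If w were a
   boundary modulo I, the coefficient u b prod_i b_i of dw at e_A would lie in
   b I + sum_i b_i I; but its support contains exactly k disjoint runs, and each
   of b, b_1, b_2, ... meets one of them. *)
Require Import Defs.
From HB Require Import structures.
From mathcomp Require Import all_boot all_order all_algebra.
From mathcomp Require Import boolp.
From mathcomp Require Import monalg.
From mathcomp Require Import mpoly.
From mathcomp Require Import zify.

Set Implicit Arguments.
Unset Strict Implicit.
Unset Printing Implicit Defensive.
Import GRing.Theory.
Local Open Scope ring_scope.

(** * Modules of finite projective dimension *)

Section Submodules.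
Variables (R : pzRingType) (V : lmodType R).

Section Subtype.
Variable W : submodClosed V.

(** A type of its own, so that kernels and ideals become modules and can stand as objects in exact
    sequences. *)
Record submodule : Type := Submodule { sub_val : V; _ : sub_val \in W }.

HB.instance Definition _ := [isSub of submodule for sub_val].
HB.instance Definition _ := [Choice of submodule by <:].
HB.instance Definition _ := [SubChoice_isSubLmodule of submodule by <:].

Lemma sub_valP (x : submodule) : sub_val x \in W.
Proof. exact: (valP x). Qed.

Lemma sub_val_inj : injective sub_val.
Proof. exact: val_inj. Qed.

Lemma sub_val_is_linear : linear sub_val.
Proof. exact: (linearP (val : submodule -> V)). Qed.

HB.instance Definition _ :=
  GRing.isLinear.Build R submodule V _ sub_val sub_val_is_linear.

End Subtype.

Variables (U : lmodType R) (f : {linear V -> U}).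

Definition kerp : {pred V} := fun x => f x == 0.

Lemma kerp_submod_closed : submod_closed kerp.
Proof.
split=> [|a u v]; first by rewrite unfold_in linear0.
by rewrite !unfold_in linearP => /eqP-> /eqP->; rewrite scaler0 addr0.
Qed.

HB.instance Definition _ := GRing.isSubmodClosed.Build R V kerp kerp_submod_closed.

End Submodules.

Section Linear.
Variable R : nzRingType.
Implicit Types A B C : lmodType R.

Lemma linear_of A B (f : A -> B) : linear f -> exists h : {linear A -> B}, h =1 f.
Proof.
move=> lf.
pose h := HB.pack_for {linear A -> B} f (GRing.isLinear.Build R A B _ f lf).
by exists h.
Qed.

(** Injectivity of [j] forces the pointwise chosen preimages to depend linearly on x. *)
Lemma linear_factor A B C (j : {linear B -> C}) (f : {linear A -> C}) :
    injective j -> (forall x, exists y, j y = f x) ->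
  exists h : {linear A -> B}, forall x, j (h x) = f x.
Proof.
move=> j_inj /choice[g gP].
have lg : linear g by move=> a u v; apply: j_inj; rewrite gP !linearP !gP.
by have [h hE] := linear_of lg; exists h => x; rewrite hE gP.
Qed.

End Linear.

(** * Short exact sequences and bounds on projective dimension *)

Section ShortExactSequences.
Variable R : nzRingType.
Implicit Types A B C M N P : lmodType R.

Definition short_exact A B C (i : {linear A -> B}) (p : {linear B -> C}) :=
  [/\ injective i, surjective p & forall x, p x = 0 <-> exists y, i y = x].

Lemma kernel_exact A B (p : {linear A -> B}) : surjective p ->
  short_exact (@sub_val _ _ (kerp p)) p.
Proof.
move=> sp; split=> // [|x]; first exact: sub_val_inj.
split=> [px|[y <-]]; last exact/eqP/(sub_valP y).
have px' : x \in kerp p by rewrite unfold_in px.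
by exists (Submodule px').
Qed.

Lemma inl_linear A B : linear (fun a : A => (a, 0) : (A * B)%type).
Proof. by move=> c u v; apply: injective_projections; rewrite //= scaler0 addr0. Qed.

Lemma inr_linear A B : linear (fun b : B => (0, b) : (A * B)%type).
Proof. by move=> c u v; apply: injective_projections; rewrite //= scaler0 addr0. Qed.

Lemma projective_prod A B : projective A -> projective B ->
  projective (A * B)%type.
Proof.
move=> pA pB X Y g f sg.
have [f1 f1E] : exists h : {linear A -> Y}, h =1 fun a => f (a, 0).
  by apply: linear_of => c u v; rewrite -linearP -inl_linear.
have [f2 f2E] : exists h : {linear B -> Y}, h =1 fun b => f (0, b).
  by apply: linear_of => c u v; rewrite -linearP -inr_linear.
have [h1 h1E] := pA _ _ g f1 sg; have [h2 h2E] := pB _ _ g f2 sg.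
have l : linear (fun x : (A * B)%type => h1 x.1 + h2 x.2).
  by move=> c u v /=; rewrite !linearP scalerDr addrACA.
have [h hE] := linear_of l; exists h => x.
rewrite hE linearD h1E h2E f1E f2E -linearD; congr (f _).
by apply: injective_projections; rewrite /= ?addr0 ?add0r.
Qed.

Lemma projective_zero M : (forall x : M, x = 0) -> projective M.
Proof.
move=> M0 A B g f sg; exists (\0 : {linear M -> A}) => x.
by rewrite (M0 x) !linear0.
Qed.

Lemma projective_regular : projective (R^o : lmodType R).
Proof.
move=> A B g f sg; have [a ga] := sg (f 1).
have l : linear (fun x : R^o => x *: a).
  by move=> c u v; rewrite scalerDl scalerA.
by have [h hE] := linear_of l; exists h => x; rewrite hE linearZ /= ga -linearZ /= [_ *: _]mulr1.
Qed.

(** A strict bound on the projective dimension: [pd_lt 0] singles out the zero module, and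
    [pd_lt m.+1] means dimension at most m. The strict form treats zero ideals uniformly in the
    inductions. *)
Fixpoint pd_lt (m : nat) (M : lmodType R) : Prop :=
  if m is m'.+1 then
    exists (P N : lmodType R) (i : {linear N -> P}) (p : {linear P -> M}),
      [/\ projective P, short_exact i p & pd_lt m' N]
  else forall x : M, x = 0.

Lemma pd_lt_zero m M : (forall x : M, x = 0) -> pd_lt m M.
Proof.
elim: m M => [//|m IHm] M M0.
exists M, (submodule (kerp (@idfun M))), (@sub_val _ _ _), idfun; split.
- exact: projective_zero.
- by apply: kernel_exact => y; exists y.
- by apply: IHm => x; apply: sub_val_inj; rewrite (M0 (sub_val x)) linear0.
Qed.

Lemma pd_ltW m m' M : (m <= m')%N -> pd_lt m M -> pd_lt m' M.
Proof.
elim: m m' M => [|m IHm] [|m'] M //; first by move=> _ /(pd_lt_zero m'.+1).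
move=> le_mm' [P [N [i [p [pP ex pdN]]]]].
by exists P, N, i, p; split=> //; apply: IHm pdN.
Qed.

(** Horseshoe argument: the projective over C lifts to B, its sum with the projective over A maps
    onto B, and the kernel of that map is an extension of [NC] by [NA]. *)
Lemma pd_lt_middle m A B C (i : {linear A -> B}) (p : {linear B -> C}) :
  short_exact i p -> pd_lt m A -> pd_lt m C -> pd_lt m B.
Proof.
elim: m A B C i p => [|m IHm] A B C i p [i_inj sp ex].
  by move=> A0 C0 x; have /ex[y <-] := C0 (p x); rewrite (A0 y) linear0.
move=> [PA [NA [iA [pA [prA [iA_inj spA exA] pdA]]]]].
move=> [PC [NC [iC [pC [prC [iC_inj spC exC] pdC]]]]].
have [l lE] := prC _ _ p pC sp.
have lg : linear (fun x : (PA * PC)%type => i (pA x.1) + l x.2).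
  by move=> c u v /=; rewrite !linearP scalerDr addrACA.
have [g gE] := linear_of lg.
have pi0 a : p (i a) = 0 by apply/ex; exists a.
have sg : surjective g.
  move=> b; have [z zE] := spC (p b).
  have /ex[a aE] : p (b - l z) = 0 by rewrite linearB lE zE subrr.
  by have [x xE] := spA a; exists (x, z); rewrite gE /= xE aE subrK.
exists (PA * PC)%type, (submodule (kerp g)), (@sub_val _ _ _), g; split.
- exact: projective_prod.
- exact: kernel_exact.
have [j jE] : exists h : {linear NA -> (PA * PC)%type}, h =1 fun x => (iA x, 0).
  by apply: linear_of => c u v; rewrite linearP -inl_linear.
have [j' j'E] : exists h : {linear NA -> submodule (kerp g)},
    forall x, sub_val (h x) = j x.
  apply: linear_factor => [|x]; first exact: sub_val_inj.
  have k : j x \in kerp g.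
    rewrite unfold_in gE jE /= linear0 addr0; apply/eqP.
    have /exA-> : exists y, iA y = iA x by exists x.
    by rewrite linear0.
  by exists (Submodule k).
have lq : linear (fun x : submodule (kerp g) => (sub_val x).2).
  by move=> c u v; rewrite linearP.
have [q qE] := linear_of lq.
have kE (x : submodule (kerp g)) : i (pA (sub_val x).1) + l (sub_val x).2 = 0.
  by rewrite -gE; exact/eqP/(sub_valP x).
have [q' q'E] : exists h : {linear submodule (kerp g) -> NC},
    forall x, iC (h x) = q x.
  apply: linear_factor => // x; apply/exC; rewrite qE.
  by have := congr1 p (kE x); rewrite linearD pi0 add0r lE linear0.
apply: (IHm _ _ _ j' q') => //; split.
- by move=> x y /(congr1 (@sub_val _ _ _)); rewrite !j'E !jE => -[/iA_inj].
- move=> y.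
  have /ex[a aE] : p (l (iC y)) = 0.
    by rewrite lE; apply/exC; exists y.
  have [x xE] := spA (- a).
  have k : (x, iC y) \in kerp g by rewrite unfold_in gE /= xE linearN aE addNr.
  by exists (Submodule k); apply: iC_inj; rewrite q'E qE.
- move=> x; split=> [qx|[y <-]]; last first.
    by apply: iC_inj; rewrite q'E qE j'E jE linear0.
  have x2 : (sub_val x).2 = 0 by rewrite -qE -q'E qx linear0.
  have /exA[y yE] : pA (sub_val x).1 = 0.
    by apply: i_inj; rewrite linear0 -[RHS](kE x) x2 linear0 addr0.
  exists y; apply: sub_val_inj; rewrite j'E jE yE.
  by case: (sub_val x) x2 => a b /= ->.
Qed.

Lemma pd_lt_prod m A B : pd_lt m A -> pd_lt m B -> pd_lt m (A * B)%type.
Proof.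
have l2 : linear (fun x : (A * B)%type => x.2) by [].
have [i iE] := linear_of (@inl_linear A B); have [p pE] := linear_of l2.
apply: (@pd_lt_middle m _ _ _ i p); split.
- by move=> x y; rewrite !iE => -[].
- by move=> y; exists (0, y); rewrite pE.
- move=> [a b]; rewrite pE /=; split=> [->|[y]]; first by exists a; rewrite iE.
  by rewrite iE => -[].
Qed.

(** If P is projective and maps onto B with kernel N, the kernel of the composite P -> C is an
    extension of A by N. When m' = 0, B and hence C vanish. *)
Lemma pd_lt_cokernel m m' A B C (i : {linear A -> B}) (p : {linear B -> C}) :
    short_exact i p -> (m < m')%N \/ m' = 0%N ->
  pd_lt m A -> pd_lt m' B -> pd_lt m' C.
Proof.
case=> i_inj sp ex [lt_mm' pdA|-> _ B0 c]; last first.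
  by have [b <-] := sp c; rewrite (B0 b) linear0.
case: m' lt_mm' => // m'; rewrite ltnS => le_mm'.
move=> [P [N [j [g [pP [j_inj sg exg] pdN]]]]].
have lr : linear (p \o g) by move=> c u v; rewrite linearP.
have [r rE] := linear_of lr.
have sr : surjective r.
  by move=> c; have [b <-] := sp c; have [x <-] := sg b; exists x; rewrite rE.
exists P, (submodule (kerp r)), (@sub_val _ _ _), r; split=> //.
  exact: kernel_exact.
have [j' j'E] : exists h : {linear N -> submodule (kerp r)},
    forall x, sub_val (h x) = j x.
  apply: linear_factor => [|x]; first exact: sub_val_inj.
  have k : j x \in kerp r.
    rewrite unfold_in rE /= (_ : g _ = 0) ?linear0 //.
    by apply/exg; exists x.
  by exists (Submodule k).
have ls : linear (fun x : submodule (kerp r) => g (sub_val x)).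
  by move=> c u v; rewrite !linearP.
have [s sE] := linear_of ls.
have [q qE] : exists h : {linear submodule (kerp r) -> A}, forall x, i (h x) = s x.
  apply: linear_factor => // x; apply/ex; rewrite sE.
  by have := sub_valP x; rewrite unfold_in rE => /eqP.
apply: (@pd_lt_middle _ _ _ _ j' q) pdN (pd_ltW le_mm' pdA); split.
- by move=> x y /(congr1 (@sub_val _ _ _)); rewrite !j'E => /j_inj.
- move=> a; have [x xE] := sg (i a).
  have k : x \in kerp r.
    by rewrite unfold_in rE /= xE; apply/eqP/ex; exists a.
  by exists (Submodule k); apply: i_inj; rewrite qE sE.
- move=> x; split=> [qx|[y <-]]; last first.
    by apply: i_inj; rewrite qE sE j'E linear0; apply/exg; exists y.
  have /exg[y yE] : g (sub_val x) = 0 by rewrite -sE -qE qx linear0.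
  by exists y; apply: sub_val_inj; rewrite j'E.
Qed.

Definition splice_module P (Q : nat -> lmodType R) (j : nat) : lmodType R :=
  if j is j'.+1 then Q j' else P.

Definition splice_map P (Q : nat -> lmodType R) (f : {linear Q 0%N -> P})
    (d : forall j, {linear Q j.+1 -> Q j}) (j : nat) :
    {linear splice_module P Q j.+1 -> splice_module P Q j} :=
  if j is j'.+1 then d j' else f.

(** The short exact sequences unfolded from [pd_lt] are spliced into one resolution. *)
Lemma pd_lt_resolution m M : pd_lt m.+1 M -> has_projective_resolution M m.
Proof.
elim: m M => [|m IHm] M [P [N [i [p [pP [i_inj sp ex] pdN]]]]].
  (* The kernel of the identity serves as the zero module in all positive degrees. *)
  pose Z := submodule (kerp (@idfun P)).
  have Z0 (x : Z) : x = 0.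
    by apply: sub_val_inj; rewrite linear0; exact/eqP/(sub_valP x).
  exists (fun j => if j is 0 then P else Z), p, (fun j => \0); split.
  - by case=> // j; apply: projective_zero.
  - by case.
  - exact: sp.
  - move=> x; rewrite ex; split=> [[y yE]|[y <-]].
      by exists 0; rewrite -yE (pdN y) !linear0.
    by exists 0; rewrite linear0.
  - move=> j x; split=> // _; exists 0.
    by rewrite (Z0 x) /= .
have [Q [e [d [pQ Q0 se exe exd]]]] := IHm _ pdN.
exists (splice_module P Q), p, (splice_map (i \o e) d); split.
- by case.
- by case=> // j; rewrite ltnS => /Q0.
- exact: sp.
- move=> x; rewrite ex; split=> [[y <-]|[y <-]]; last by exists (e y).
  by have [z <-] := se y; exists z.
- case=> [|j] x; last exact: exd.
  by rewrite -exe /=; split=> [|->]; rewrite ?linear0 // => ix; apply: i_inj; rewrite linear0.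
Qed.

End ShortExactSequences.

(** * The Koszul complex *)

Section KoszulComplex.
Variable R : comNzRingType.
Implicit Types M N P : lmodType R.
Implicit Types s : seq R.

(** An iterated mapping cone: the pair (c1, c2) stands for c1 + e_y c2, with boundary d c1 + y c2 -
    e_y d c2. All degrees live in a single module; the grading enters only through [koszul_ge]. *)
Fixpoint koszul s M : lmodType R :=
  if s is _ :: s' then (koszul s' M * koszul s' M)%type else M.

Fixpoint koszul_d s M : koszul s M -> koszul s M :=
  match s return koszul s M -> koszul s M with
  | [::] => fun=> 0
  | y :: s' => fun c => (koszul_d c.1 + y *: c.2, - koszul_d c.2)
  end.

Lemma koszul_d_linear s M : linear (@koszul_d s M).
Proof.
elim: s => [|y s IHs] a u v; first by rewrite /= scaler0 addr0.
apply: injective_projections => /=; rewrite !IHs.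
  by rewrite !scalerDr !scalerA (mulrC y) addrACA.
by rewrite opprD scalerN.
Qed.

HB.instance Definition _ s M :=
  GRing.isLinear.Build R (koszul s M) (koszul s M) _ (@koszul_d s M)
    (@koszul_d_linear s M).

Lemma koszul_dd s M (c : koszul s M) : koszul_d (koszul_d c) = 0.
Proof.
elim: s c => //= y s IHs c; apply: injective_projections => /=.
  by rewrite linearD linearZ /= IHs add0r scalerN subrr.
by rewrite linearN /= IHs !oppr0.
Qed.

Fixpoint koszul_map s M N (f : M -> N) : koszul s M -> koszul s N :=
  match s return koszul s M -> koszul s N with
  | [::] => f
  | _ :: _ => fun c => (koszul_map f c.1, koszul_map f c.2)
  end.

Lemma koszul_map_linear s M N (f : {linear M -> N}) :
  linear (koszul_map f : koszul s M -> koszul s N).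
Proof.
elim: s => [|y s IHs] a u v /=; first by rewrite linearP.
by apply: injective_projections; rewrite /= IHs.
Qed.

HB.instance Definition _ s M N (f : {linear M -> N}) :=
  GRing.isLinear.Build R (koszul s M) (koszul s N) _ (koszul_map f)
    (@koszul_map_linear s M N f).

Lemma koszul_map_d s M N (f : {linear M -> N}) (c : koszul s M) :
  koszul_map f (koszul_d c) = koszul_d (koszul_map f c).
Proof.
elim: s c => [|y s IHs] c /=; first by rewrite linear0.
by rewrite linearD linearZ linearN /= !IHs.
Qed.

(* The chains with no component in degrees below j. *)
Fixpoint koszul_ge s M (j : nat) : koszul s M -> Prop :=
  match s return koszul s M -> Prop with
  | [::] => fun c => (0 < j)%N -> c = 0
  | _ :: _ => fun c => koszul_ge j c.1 /\ koszul_ge j.-1 c.2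
  end.

Lemma koszul_ge0 s M j : koszul_ge j (0 : koszul s M).
Proof. by elim: s j => //= y s IHs j; split; apply: IHs. Qed.

Lemma koszul_geP s M j a (u v : koszul s M) :
  koszul_ge j u -> koszul_ge j v -> koszul_ge j (a *: u + v).
Proof.
elim: s j u v => [|y s IHs] j u v /=.
  by move=> u0 v0 j0; rewrite u0 // v0 // scaler0 addr0.
by move=> [u1 u2] [v1 v2]; split; apply: IHs.
Qed.

Lemma koszul_geD s M j (u v : koszul s M) :
  koszul_ge j u -> koszul_ge j v -> koszul_ge j (u + v).
Proof. by move=> ju jv; rewrite -[u]scale1r; apply: koszul_geP. Qed.

Lemma koszul_geZ s M j a (u : koszul s M) : koszul_ge j u -> koszul_ge j (a *: u).
Proof. by move=> ju; rewrite -[_ *: _]addr0; apply: koszul_geP => //; exact: koszul_ge0. Qed.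

Lemma koszul_geN s M j (u : koszul s M) : koszul_ge j u -> koszul_ge j (- u).
Proof. by rewrite -scaleN1r; apply: koszul_geZ. Qed.

Lemma koszul_ge_le s M i j (u : koszul s M) : (i <= j)%N ->
  koszul_ge j u -> koszul_ge i u.
Proof.
elim: s i j u => [|y s IHs] i j u le_ij /=.
  by move=> u0 i0; apply: u0; apply: leq_trans le_ij.
case=> u1 u2; split; first exact: IHs u1.
by apply: IHs u2; rewrite -!subn1 leq_sub2r.
Qed.

Lemma koszul_geT s M (u : koszul s M) : koszul_ge 0 u.
Proof. by elim: s u => //= y s IHs u; split; apply: IHs. Qed.

Lemma koszul_ge_d s M j (u : koszul s M) : koszul_ge j u -> koszul_ge j.-1 (koszul_d u).
Proof.
elim: s j u => [|y s IHs] j u //= [u1 u2]; split.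
  by apply: koszul_geD; [exact: IHs | exact: koszul_geZ].
by apply: koszul_geN; apply: IHs.
Qed.

Lemma koszul_ge_map s M N (f : {linear M -> N}) j (u : koszul s M) :
  koszul_ge j u -> koszul_ge j (koszul_map f u).
Proof.
elim: s j u => [|y s IHs] j u /=; first by move=> u0 /u0 ->; rewrite linear0.
by case=> u1 u2; split; apply: IHs.
Qed.

Fixpoint koszul_deg0 s M : koszul s M -> M :=
  match s return koszul s M -> M with
  | [::] => id
  | _ :: _ => fun c => koszul_deg0 c.1
  end.

Fixpoint koszul_inj0 s M (m : M) : koszul s M :=
  match s return koszul s M with
  | [::] => m
  | _ :: _ => (koszul_inj0 _ m, 0)
  end.

Lemma koszul_inj0K s M : cancel (@koszul_inj0 s M) (@koszul_deg0 s M).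
Proof. by elim: s. Qed.

Lemma koszul_deg0_linear s M : linear (@koszul_deg0 s M).
Proof. by elim: s => // y s IHs a u v; rewrite /= IHs. Qed.

HB.instance Definition _ s M :=
  GRing.isLinear.Build R (koszul s M) M _ (@koszul_deg0 s M)
    (@koszul_deg0_linear s M).

Lemma koszul_ge1P s M (u : koszul s M) : koszul_deg0 u = 0 -> koszul_ge 1 u.
Proof.
by elim: s u => //= y s IHs u /IHs; split=> //; apply: koszul_geT.
Qed.

(** Membership in the submodule s M, by the same recursion on s as the Koszul complex. *)
Fixpoint in_span s M (m : M) : Prop :=
  if s is y :: s' then exists m1 m', m = y *: m1 + m' /\ in_span s' m' else m = 0.

Lemma in_spanP s M a (u v : M) : in_span s u -> in_span s v -> in_span s (a *: u + v).
Proof.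
elim: s u v => [|y s IHs] u v /=; first by move=> -> ->; rewrite scaler0 addr0.
move=> [u1 [u' [-> su]]] [v1 [v' [-> sv]]].
exists (a *: u1 + v1), (a *: u' + v'); split; last exact: IHs.
by rewrite !scalerDr !scalerA (mulrC y) addrACA.
Qed.

Lemma in_span0 s M : in_span s (0 : M).
Proof.
by elim: s => //= y s IHs; exists 0, 0; rewrite scaler0 addr0.
Qed.

Lemma in_spanD s M (u v : M) : in_span s u -> in_span s v -> in_span s (u + v).
Proof. by move=> su sv; rewrite -[u]scale1r; apply: in_spanP. Qed.

Lemma in_span_map s M N (f : {linear M -> N}) m : in_span s m -> in_span s (f m).
Proof.
elim: s m => [|y s IHs] m /=; first by move->; rewrite linear0.
by move=> [m1 [m' [-> /IHs sm]]]; exists (f m1), (f m'); rewrite linearP.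
Qed.

(** The Koszul homology in degree 0 is M / s M. *)
Lemma in_span_deg0_d s M (m : M) : in_span s m <->
  exists2 u : koszul s M, koszul_ge 1 u & koszul_deg0 (koszul_d u) = m.
Proof.
elim: s m => [|y s IHs] m /=.
  by split=> [->|[u _ <-]//]; exists 0.
split=> [[m1 [m' [-> /IHs[u u1 uE]]]]|[[u1 u2] /= [u1_ge _] uE]].
  exists (u, koszul_inj0 _ m1); first by split=> //; apply: koszul_geT.
  by rewrite /= linearD linearZ /= uE koszul_inj0K addrC.
exists (koszul_deg0 u2), (koszul_deg0 (koszul_d u1)); split; last by apply/IHs; exists u1.
by rewrite -uE linearD linearZ /= addrC.
Qed.

(* Regularity of the reversed sequence: y is a nonzerodivisor on M / s' M for
   every suffix y :: s'. *)
Fixpoint regular_on s M : Prop :=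
  if s is y :: s' then
    (forall m : M, in_span s' (y *: m) -> in_span s' m) /\ regular_on s' M
  else True.

(** For a cycle c1 + e_y c2, first c2 is written as d u, then the cycle c1 + y u as d v; the chain v
    - e_y u has the required boundary. *)
Lemma koszul_acyclic s M : regular_on s M ->
  forall j (c : koszul s M), (0 < j)%N -> koszul_ge j c -> koszul_d c = 0 ->
  exists2 v, koszul_ge j.+1 v & koszul_d v = c.
Proof.
elim: s => [_ j c j0 /(_ j0) -> _|y s IHs [yreg /IHs{}IHs] j [c1 c2] j0 [] /=].
  by exists 0 => //.
move=> ge1 ge2 [] d1 /(canRL opprK); rewrite oppr0 => d2.
have [u u_ge uE] : exists2 u : koszul s M, koszul_ge j u & koszul_d u = c2.
  (* Only j = 1 needs regularity of y: there c2 may have a component in degree 0, which must be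
     shown to lie in the span of s. *)
  case: j j0 ge1 ge2 => // -[_ ge1 _|j _ _ ge2]; last exact: IHs.
  have : in_span s (y *: koszul_deg0 c2).
    have /eqP := congr1 (@koszul_deg0 _ _) d1.
    rewrite linearD linearZ /= linear0 addrC addr_eq0 => /eqP->.
    rewrite -scaleN1r -[_ *: _]addr0; apply: in_spanP; last exact: in_span0.
    by apply/in_span_deg0_d; exists c1.
  move=> /yreg/in_span_deg0_d[u u1 uE].
  have [||v v2 vE] := IHs 1%N (c2 - koszul_d u) isT.
  - by apply: koszul_ge1P; rewrite linearB /= uE subrr.
  - by rewrite linearB /= d2 koszul_dd subrr.
  exists (u + v); last by rewrite linearD /= vE addrC subrK.
  by apply: koszul_geD => //; apply: koszul_ge_le v2.
have [||v v_ge vE] := IHs j (c1 + y *: u) j0.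
- by apply: koszul_geD => //; apply: koszul_geZ.
- by rewrite linearD linearZ /= uE.
exists (v, - u); first by split=> //; apply: koszul_geN.
by rewrite /= vE scalerN addrK linearN /= uE opprK.
Qed.

Lemma regular_retract s M N (f : {linear M -> N}) (g : {linear N -> M}) :
  cancel f g -> regular_on s N -> regular_on s M.
Proof.
move=> fK; elim: s => //= y s IHs [yreg /IHs sreg]; split=> // m.
move=> /(in_span_map f); rewrite linearZ /= => /yreg/(in_span_map g).
by rewrite fK.
Qed.

Lemma in_span_malg s (T : choiceType) (f : {malg R[T]}) :
  in_span s f <-> forall k, in_span s (monalg.mcoeff k f : R^o).
Proof.
split=> [sf k|sf].
  have l : linear (monalg.mcoeff k : {malg R[T]} -> R^o).
    by move=> a u v; rewrite monalg.mcoeffD monalg.mcoeffZ.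
  by have [h hE] := linear_of l; rewrite -hE; apply: in_span_map.
rewrite [f]monalg.monalgE; elim/big_ind: _ => [|u v|k _].
- exact: in_span0.
- exact: in_spanD.
have l : linear (fun x : R^o => monalg.mkmalgU k x : {malg R[T]}).
  move=> a u v; apply/monalg.malgP => k'.
  by rewrite monalg.mcoeffD monalg.mcoeffZ !monalg.mcoeffU mulrnDl mulrnAr.
by have [h hE] := linear_of l; rewrite -hE; apply: in_span_map.
Qed.

Lemma regular_malg s (T : choiceType) : regular_on s (R^o : lmodType R) ->
  regular_on s ({malg R[T]} : lmodType R).
Proof.
elim: s => //= y s IHs [yreg /IHs sreg]; split=> // m /in_span_malg sm.
by apply/in_span_malg => k; apply: yreg; have := sm k; rewrite monalg.mcoeffZ.
Qed.

(** A projective module is a retract of the free module on its own underlying set, where regularity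
    is checked coefficient by coefficient. *)
Lemma regular_projective s P : regular_on s (R^o : lmodType R) -> projective P ->
  regular_on s P.
Proof.
move=> sreg pP.
pose ev (f : {malg R[P]}) :=
  \sum_(x <- finmap.enum_fset (monalg.msupp f)) monalg.mcoeff x f *: x.
(* Enlarging the finite index set does not change the value, so linearity can be checked over one
   common set. *)
have evE (f : {malg R[P]}) (D : finmap.finset_of (Phant P)) :
    finmap.fsubset (monalg.msupp f) D ->
  ev f = \sum_(x <- finmap.enum_fset D) monalg.mcoeff x f *: x.
  move=> fD; apply: finmap.big_fset_incl => // x _ xf.
  by rewrite (monalg.mcoeff_outdom xf) scale0r.
have l : linear ev.
  move=> a u v.
  set D := finmap.fsetU (monalg.msupp u) (monalg.msupp v).
  have uD : finmap.fsubset (monalg.msupp u) D by exact: finmap.fsubsetUl.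
  have vD : finmap.fsubset (monalg.msupp v) D by exact: finmap.fsubsetUr.
  rewrite !(evE _ D) // ?scaler_sumr -?big_split /=.
    by apply: eq_bigr => x _; rewrite monalg.mcoeffD monalg.mcoeffZ scalerDl scalerA.
  apply: finmap.fsubset_trans (monalg.msuppD_le _ _) _.
  by apply: finmap.fsetSU; apply: monalg.msuppZ_le.
have [g gE] := linear_of l.
have sg : surjective g.
  move=> x; exists (monalg.mkmalgU x 1).
  rewrite gE /ev monalg.msuppU oner_eq0 finmap.big_seq_fset1.
  by rewrite monalg.mcoeffUU scale1r.
have [h hE] := pP _ _ g idfun sg.
exact: regular_retract hE (regular_malg _ sreg).
Qed.

Lemma koszul_map_surj s M N (f : {linear M -> N}) j (c : koszul s N) :
    surjective f -> koszul_ge j c ->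
  exists2 c' : koszul s M, koszul_ge j c' & koszul_map f c' = c.
Proof.
move=> sf; elim: s j c => [|y s IHs] j c /=.
  case: j => [_|j /(_ isT) ->]; first by have [m mE] := sf c; exists m.
  by exists 0; rewrite ?linear0.
by case=> /IHs[u1 ? u1E] /IHs[u2 ? u2E]; exists (u1, u2); rewrite //= u1E u2E -surjective_pairing.
Qed.

Lemma koszul_map_exact s M N P (f : {linear M -> N}) (g : {linear N -> P}) :
    (forall x, g x = 0 -> exists y, f y = x) ->
  forall j (c : koszul s N), koszul_ge j c -> koszul_map g c = 0 ->
  exists2 c' : koszul s M, koszul_ge j c' & koszul_map f c' = c.
Proof.
move=> ex; elim: s => [|y s IHs] j c /=.
  case: j => [_ /ex[m mE]|j /(_ isT) -> _]; first by exists m.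
  by exists 0; rewrite ?linear0.
case=> ge1 ge2 [/(IHs _ _ ge1)[u1 ? u1E] /(IHs _ _ ge2)[u2 ? u2E]].
by exists (u1, u2); rewrite //= u1E u2E -surjective_pairing.
Qed.

(** A chase in the double complex of the Koszul complexes of the P i. Each step along the resolution
    lowers the Koszul degree by one; since j > l, the degree is still positive when the resolution
    ends. *)
Lemma koszul_resolution s M l : regular_on s (R^o : lmodType R) ->
    has_projective_resolution M l ->
  forall j (c : koszul s M), (l < j)%N -> koszul_ge j c -> koszul_d c = 0 ->
  exists v, koszul_d v = c.
Proof.
move=> sreg [P [e [d [pP P0 se exe exd]]]].
have acyc i := koszul_acyclic (regular_projective sreg (pP i)).
have comp (A B C : lmodType R) (f : {linear A -> B}) (g : {linear B -> C})
    (u : koszul s A) : (forall x, g (f x) = 0) -> koszul_map g (koszul_map f u) = 0.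
  move=> gf; elim: (s) u => [|y s' IHs] u /=; first exact: gf.
  by rewrite !IHs.
(* If the boundary of c comes from P (i+1), then c is itself a boundary modulo chains from P (i+1).
   The induction is on the number m of steps left to the end of the resolution. *)
have key m i : (i + m)%N = l -> forall j (c : koszul s (P i)), (m < j)%N ->
    koszul_ge j c ->
    (exists2 c', koszul_ge j.-1 c' & koszul_map (d i) c' = koszul_d c) ->
  exists v u, koszul_ge j.+1 v /\ c = koszul_d v + koszul_map (d i) u.
  elim: m i => [|m IHm] i il j c mj cj [c' c'j c'E].
    (* Here i = l and P (l+1) is zero, so c is a genuine cycle. *)
    have dc : koszul_d c = 0.
      rewrite -c'E; elim: (s) (c') => [|y s' IHs] u /=; last by rewrite !IHs.
      by rewrite (P0 i.+1 _ u) ?linear0 // -il addn0.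
    have [v vj vE] := acyc _ j c mj cj dc.
    by exists v, 0; rewrite linear0 addr0.
  have dc' : koszul_map (d i) (koszul_d c') = 0.
    by rewrite koszul_map_d c'E koszul_dd.
  have exact_i x : d i x = 0 -> exists y, d i.+1 y = x by move/exd.
  have [c2 c2j c2E] := koszul_map_exact exact_i (koszul_ge_d c'j) dc'.
  have il' : (i.+1 + m)%N = l by rewrite addSnnS.
  have mj' : (m < j.-1)%N by case: (j) mj.
  have jE : j.-1.+1 = j by case: (j) mj.
  have [|v [u [vj uE]]] := IHm _ il' j.-1 c' mj' c'j; first by exists c2.
  rewrite jE in vj.
  (* As c' = d v + [d i.+1] u and consecutive maps of the resolution compose to zero, removing the
     image of v from c leaves a cycle. *)
  have [||w wj wE] := acyc i j (c - koszul_map (d i) v) (leq_ltn_trans (leq0n _) mj).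
  - by apply: koszul_geD => //; apply/koszul_geN/koszul_ge_map.
  - rewrite linearB /= -koszul_map_d -c'E uE linearD /= comp ?addr0 ?subrr // => x.
    by apply/exd; exists x.
  by exists w, v; split=> //; rewrite wE subrK.
move=> j c lj cj dc.
have [c0 c0j c0E] := koszul_map_surj se cj.
have dc0 : koszul_map e (koszul_d c0) = 0 by rewrite koszul_map_d c0E.
have exact_e x : e x = 0 -> exists y, d 0%N y = x by move/exe.
have [c1 c1j c1E] := koszul_map_exact exact_e (koszul_ge_d c0j) dc0.
have [|v [u [_ uE]]] := key l 0%N (add0n l) j c0 lj c0j; first by exists c1.
exists (koszul_map e v); rewrite -koszul_map_d -c0E uE linearD /= comp ?addr0 // => x.
by apply/exe; exists x.
Qed.

End KoszulComplex.

(** * Products of Koszul cycles *)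

Section KoszulBrackets.
Variable R : comNzRingType.
Implicit Types (s : seq R) (ps : seq (R * R)).

Fixpoint bracket_seq ps s : seq R :=
  if ps is p :: ps' then p.1 :: p.2 :: bracket_seq ps' s else s.

(* The product of w with the 1-cycles p.1 e_(p.2) - p.2 e_(p.1), for p in ps. *)
Fixpoint bracket_prod (M : lmodType R) ps s (w : koszul s M) : koszul (bracket_seq ps s) M :=
  match ps return koszul (bracket_seq ps s) M with
  | [::] => w
  | p :: ps' => ((0, p.1 *: bracket_prod ps' w), (- p.2 *: bracket_prod ps' w, 0))
  end.

(** The boundary is a graded derivation and every factor a e_b - b e_a is a cycle, so only a sign is
    picked up per factor. *)
Lemma koszul_d_bracket (M : lmodType R) ps s (w : koszul s M) :
  koszul_d (bracket_prod ps w) = (-1) ^+ size ps *: bracket_prod ps (koszul_d w).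
Proof.
elim: ps => [|[a b] ps IHps] /=; first by rewrite scale1r.
apply: injective_projections; apply: injective_projections => /=.
- rewrite linear0 add0r !scalerA mulrN [b * _]mulrC scaleNr subrr ?scaler0 //.
- rewrite !linearZ /= IHps scaler0 addr0 !scalerA exprS.
  by rewrite mulN1r scalerN mulrN scaleNr scalerA.
- rewrite !linearZ /= IHps scaler0 addr0 !scalerA exprS.
  by rewrite mulN1r mulrN [RHS]scaleNr.
- by rewrite !linear0.
Qed.

(** The top-degree chain u e_s, where e_s is the product of all e_y with y in s. *)
Fixpoint koszul_top (M : lmodType R) s (u : M) : koszul s M :=
  match s return koszul s M with
  | [::] => u
  | _ :: s' => (0, koszul_top s' u)
  end.

Fixpoint koszul_top_coef (M : lmodType R) s : koszul s M -> M :=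
  match s return koszul s M -> M with
  | [::] => id
  | _ :: s' => fun c => koszul_top_coef c.2
  end.

Lemma koszul_top_coef_linear (M : lmodType R) s : linear (@koszul_top_coef M s).
Proof. by elim: s => // y s IHs a u v; rewrite /= IHs. Qed.

HB.instance Definition _ (M : lmodType R) s :=
  GRing.isLinear.Build R (koszul s M) M _ (@koszul_top_coef M s)
    (@koszul_top_coef_linear M s).

Lemma koszul_topK (M : lmodType R) s : cancel (@koszul_top M s) (@koszul_top_coef M s).
Proof. by elim: s. Qed.

Lemma koszul_top_coef_d (M : lmodType R) s (c : koszul s M) : koszul_top_coef (koszul_d c) = 0.
Proof. by elim: s c => //= y s IHs c; rewrite linearN /= IHs oppr0. Qed.

Lemma koszul_ge_top (M : lmodType R) s (u : M) : koszul_ge (size s) (koszul_top s u).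
Proof. by elim: s => //= y s IHs; split=> //; apply: koszul_ge0. Qed.

Lemma koszul_ge_bracket (M : lmodType R) ps s (w : koszul s M) j :
  koszul_ge j w -> koszul_ge (size ps + j) (bracket_prod ps w).
Proof.
elim: ps => [|p ps IHps] //= /IHps wj.
by split; split; try exact: koszul_ge0; apply: koszul_geZ.
Qed.

(* The coefficient of the product of all e_(p.1), p in ps. *)
Fixpoint bracket_coef (M : lmodType R) ps s : koszul (bracket_seq ps s) M -> koszul s M :=
  match ps return koszul (bracket_seq ps s) M -> koszul s M with
  | [::] => id
  | _ :: ps' => fun c => bracket_coef c.2.1
  end.

Lemma bracket_coef_linear (M : lmodType R) ps s : linear (@bracket_coef M ps s).
Proof. by elim: ps => // p ps IHps a u v; rewrite /= IHps. Qed.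

HB.instance Definition _ (M : lmodType R) ps s :=
  GRing.isLinear.Build R (koszul (bracket_seq ps s) M) (koszul s M) _
    (@bracket_coef M ps s) (@bracket_coef_linear M ps s).

Lemma bracket_coef_prod (M : lmodType R) ps s (w : koszul s M) :
  bracket_coef (bracket_prod ps w) = (-1) ^+ size ps * \prod_(p <- ps) p.2 *: w.
Proof.
elim: ps => [|p ps IHps] /=; first by rewrite big_nil mulr1 scale1r.
rewrite linearZ /= IHps scalerA big_cons exprS; congr (_ *: w).
by rewrite mulN1r !mulNr mulrCA.
Qed.

Fixpoint koszul_all (M : lmodType R) (Q : M -> Prop) s : koszul s M -> Prop :=
  match s return koszul s M -> Prop with
  | [::] => Q
  | _ :: s' => fun c => koszul_all Q c.1 /\ koszul_all Q c.2
  end.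

Lemma koszul_all0 (M : lmodType R) (Q : M -> Prop) s : Q 0 -> koszul_all Q (0 : koszul s M).
Proof. by move=> Q0; elim: s => //= y s IHs. Qed.

Lemma koszul_map_all (M N : lmodType R) (f : {linear M -> N}) s (c : koszul s M) :
  koszul_map f c = 0 <-> koszul_all (fun x => f x = 0) c.
Proof.
elim: s c => //= y s IHs c; split=> [[/IHs ? /IHs ?]|[/IHs -> /IHs ->]] //.
Qed.

(** Choosing one entry from each pair gives, up to sign, the coefficients occurring in
    [bracket_prod]. *)
Fixpoint transversal_prods ps : seq R :=
  if ps is p :: ps' then
    [seq p.1 * x | x <- transversal_prods ps'] ++
    [seq p.2 * x | x <- transversal_prods ps']
  else [:: 1].

Lemma koszul_all_bracket (M : lmodType R) (W : submodClosed M) ps s (z : koszul s M) :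
    (forall x, x \in transversal_prods ps ->
      koszul_all (fun m => m \in W) (x *: z)) ->
  koszul_all (fun m => m \in W) (bracket_prod ps z).
Proof.
elim: ps z => [|p ps IHps] z /= zW.
  by rewrite -[z]scale1r; apply: zW; rewrite mem_head.
have E x : x *: bracket_prod ps z = bracket_prod ps (x *: z).
  elim: (ps) => //= q qs IHqs; apply: injective_projections; apply: injective_projections;
    by rewrite /= ?scaler0 // -IHqs !scalerA mulrC.
split; split; try (apply: koszul_all0; exact: rpred0); rewrite E; apply: IHps => x xps.
  by rewrite scalerA mulrC; apply: zW; rewrite mem_cat map_f.
have xz : koszul_all (fun m => m \in W) (p.2 * x *: z).
  by apply: zW; rewrite mem_cat map_f ?orbT.
rewrite scalerA mulrN mulrC scaleNr; elim: (s) (z) xz => [|y s' IHs] z' /=.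
  by rewrite -scaleN1r; apply: rpredZ.
by case=> ? ?; split; apply: IHs.
Qed.

Lemma koszul_all_d_top (M : lmodType R) (W : submodClosed M) s (u : M) (x : R) :
    (forall y, y \in s -> (x * y) *: u \in W) ->
  koszul_all (fun m => m \in W) (x *: koszul_d (koszul_top s u)).
Proof.
elim: s x => [|y s IHs] x uW /=; first by rewrite scaler0 rpred0.
split.
  rewrite linear0 add0r scalerA.
  have : (x * y) *: u \in W by apply: uW; rewrite mem_head.
  elim: (s) => [|y' s' IHs'] //= uW'; split; last exact: IHs'.
  by rewrite scaler0; apply: koszul_all0; apply: rpred0.
rewrite scalerN -scaleNr; apply: IHs => y' y's.
by rewrite mulNr scaleNr -scaleN1r; apply/rpredZ/uW; rewrite inE y's orbT.
Qed.

(** The coefficient of d c at e_A, with A made of all p.1 and of s, is a signed sum of products y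
    c_(A + y) with y outside A. Those y are b0 and the p.2, and [phi] kills each such product. *)
Lemma bracket_coef_boundary (W : {pred R^o}) (V : zmodType) (phi : {additive R -> V})
    ps b0 s (c : koszul (bracket_seq ps (b0 :: s)) R^o) :
    (forall b x, b \in b0 :: map snd ps -> x \in W -> phi (b * x) = 0) ->
    koszul_all (fun m => m \in W) c ->
  phi (koszul_top_coef (bracket_coef (koszul_d c)).1) = 0.
Proof.
move=> phiW.
have topW s' (c' : koszul s' R^o) : koszul_all (fun m => m \in W) c' -> koszul_top_coef c' \in W.
  by elim: s' c' => //= y s' IHs c' [_ /IHs].
elim: ps c phiW => [|p ps IHps] c phiW /= [c1W c2W].
  (* Chains without e_(b0) contribute nothing to their own top degree, so only b0 times a
     coefficient in W remains. *)
  rewrite linearD linearZ /= koszul_top_coef_d add0r.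
  by rewrite [_ *: _]/(_ * _) phiW ?mem_head ?topW.
rewrite linearN linearD linearZ /= linearN linearD linearZ /= !raddfN !raddfD /=.
rewrite IHps; last 2 first.
- by move=> b x; rewrite inE => bps; apply: phiW; rewrite !inE; case/orP: bps => ->; rewrite ?orbT.
- by case: c2W.
(* This component contains both e_(p.1) and e_(p.2); removing e_(p.2) produces the factor p.2. *)
have : koszul_all (fun m => m \in W) (bracket_coef c.2.2).
  case: c2W => _; elim: (ps) (c.2.2) => //= q qs IHqs c' [_ [c'W _]].
  exact: IHqs.
case=> cW _; rewrite oppr0 add0r [_ *: _]/(_ * _) phiW ?oppr0 //; last exact: topW.
by rewrite !inE eqxx orbT.
Qed.

(** The additive map [phi] replaces the ideal generated by the products b x with x in W: it vanishes
    on them but not on the relevant coefficient of d w. If l were smaller than the degree of w, the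
    class of w would be a boundary. *)
Theorem koszul_lower_bound (W : submodClosed (R^o : lmodType R)) (V : zmodType)
    (phi : {additive R -> V}) ps b0 s (u : R) l :
    regular_on (bracket_seq ps (b0 :: s)) (R^o : lmodType R) ->
    (forall x y, x \in transversal_prods ps -> y \in b0 :: s -> x * y * u \in W) ->
    (forall b x, b \in b0 :: map snd ps -> x \in W -> phi (b * x) = 0) ->
    phi (\prod_(p <- ps) p.2 * (b0 * u)) != 0 ->
    has_projective_resolution (quotient_module W) l ->
  (size ps + (size s).+1 <= l)%N.
Proof.
move=> sreg uW phiW phiu res; rewrite leqNgt; apply/negP => l_lt.
have lpi : linear (@quot_proj _ _ W : R^o -> quotient_module W).
  by move=> a x y; rewrite quot_projD -quot_scale_proj.
have [pi piE] := linear_of lpi.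
have pi0 x : pi x = 0 <-> x \in W.
  have -> : 0 = pi 0 by rewrite linear0.
  by rewrite !piE quot_proj_eq subr0.
have spi : surjective pi.
  by move=> x; have [v vE] := quot_projP x; exists v; rewrite piE.
have all0 t (c : koszul t R^o) : koszul_map pi c = 0 <-> koszul_all (fun m => m \in W) c.
  rewrite koszul_map_all; elim: t c => [|y t IHt] c /=; first exact: pi0.
  by rewrite !IHt.
pose w := bracket_prod ps (koszul_top (b0 :: s) (u : R^o)).
have w_ge : koszul_ge (size ps + (size s).+1) w.
  by apply: koszul_ge_bracket; apply: (koszul_ge_top (b0 :: s)).
have dw : koszul_d (koszul_map pi w) = 0.
  rewrite -koszul_map_d koszul_d_bracket linearZ /=.
  have /all0-> : koszul_all (fun m => m \in W)
      (bracket_prod ps (koszul_d (koszul_top (b0 :: s) (u : R^o)))).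
    apply: koszul_all_bracket => x xps; apply: koszul_all_d_top => y ys.
    exact: uW.
  by rewrite scaler0.
have [v vE] := koszul_resolution sreg res l_lt (koszul_ge_map pi w_ge) dw.
have [v' _ v'E] := koszul_map_surj spi (koszul_geT v).
(* All entries of w - d v' lie in W, and its boundary is d w, so the previous lemma forces [phi] to
   vanish on the coefficient of d w. *)
have /all0 iW : koszul_map pi (w - koszul_d v') = 0.
  by rewrite linearB /= koszul_map_d v'E vE subrr.
have := bracket_coef_boundary phiW iW.
rewrite linearB /= koszul_dd subr0 koszul_d_bracket linearZ /= bracket_coef_prod scalerA.
move/eqP; apply/negP.
(* The sign from moving d past the brackets cancels the one from selecting the terms in e_(p.1). *)
rewrite mulrA -expr2 sqrr_sign mul1r.
rewrite linearZ /= linear0 add0r linearZ /= koszul_topK.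
exact: phiu.
Qed.

End KoszulBrackets.

(** * Runs of consecutive integers *)

Section RunMatchings.
Variable t : nat.
Local Open Scope nat_scope.
Implicit Types (P : pred nat) (n k p : nat).

(* P contains k disjoint runs of t consecutive integers below n; i starts the last one. *)
Fixpoint run_matching P n k : Prop :=
  if k is k'.+1 then
    exists i, [/\ i + t <= n, forall j, i <= j < i + t -> P j & run_matching P i k']
  else True.

Lemma run_matching_mono P P' n n' k :
    (forall j, j < n -> P j -> P' j) -> n <= n' ->
  run_matching P n k -> run_matching P' n' k.
Proof.
elim: k n n' => //= k IHk n n' PP' nn' [i [le_in Pi mi]].
exists i; split=> [|j ij|]; first exact: leq_trans nn'.
- by apply: PP'; [lia | exact: Pi].
- by apply: IHk mi => // j ji; apply: PP'; lia.
Qed.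

Lemma run_matching_anti P n k k' : k' <= k -> run_matching P n k -> run_matching P n k'.
Proof.
elim: k' k n => //= k' IHk [//|k] n le_k /= [i [le_in Pi mi]].
by exists i; split=> //; apply: IHk mi.
Qed.

Lemma run_matching_leq P n k : run_matching P n k -> k * t <= n.
Proof. by elim: k n => //= k IHk n [i [le_in _ /IHk]]; rewrite mulSn; lia. Qed.


(** The dichotomy behind the recursion for A(N,k): the last run either ends at n or lies below
    n-1. *)
Lemma run_matching_last P n k :
  run_matching P n k.+1 <->
    run_matching P n.-1 k.+1 \/
    [/\ t <= n, forall j, n - t <= j < n -> P j & run_matching P (n - t) k].
Proof.
split=> /= [[i [le_in Pi mi]]|[[i [le_in Pi mi]]|[le_tn Pn mn]]].
- case: (ltnP (i + t) n) => [lt_in|ge_in]; first by left; exists i; split=> //; lia.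
  have -> : n = i + t by apply/eqP; rewrite eqn_leq le_in ge_in.
  by right; rewrite addnK leq_addl.
- by exists i; split=> //; lia.
- by exists (n - t); rewrite subnK.
Qed.

Hypothesis t_gt0 : 0 < t.

(** A run avoiding n lies below n or is exactly n+1, ..., n+t. Hence dropping the last run leaves k
    runs below n. *)
Lemma run_matching_gap P n k : ~~ P n ->
  run_matching P (n + t).+1 k.+1 -> run_matching P n k.
Proof.
move=> Pn /= [i [le_in Pi mi]].
case: (leqP i n) => in_; last first.
  apply: (run_matching_mono _ (leqnn n)) (_ : run_matching P n k) => //.
  have -> : n = i.-1 by lia.
  case: k mi => //= k [i' [le_in' Pi' mi']]; exists i'; split=> //.
  rewrite leqNgt; apply/negP => lt; have ni : n = i' + t.-1 by lia.
  by move: Pn; rewrite Pi' //; lia.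
have in' : i + t <= n.
  by rewrite leqNgt; apply/negP => lt; move: Pn; rewrite Pi //; lia.
by apply: (run_matching_mono _ _ mi) => //; lia.
Qed.

(** With both n and n+t missing, only t-1 places remain between them, too few for a run. *)
Lemma run_matching_gap2 P n k : ~~ P n -> ~~ P (n + t) ->
  run_matching P (n + t).+1 k -> run_matching P n k.
Proof.
case: k => //= k Pn Pnt [i [le_in Pi mi]]; exists i; split=> //.
rewrite leqNgt; apply/negP => lt.
case: (leqP i n) => in_; first by move: Pn; rewrite Pi //; lia.
by move: Pnt; rewrite Pi //; lia.
Qed.

Arguments run_matching P n k : simpl never.

Fixpoint transversals (T : Type) (ps : seq (T * T)) : seq (seq T) :=
  if ps is p :: ps' then
    map (cons p.1) (transversals ps') ++ map (cons p.2) (transversals ps')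
  else [:: [::]].

Definition ends (ps : seq (nat * nat)) : seq nat := flatten [seq [:: q.1; q.2] | q <- ps].

Lemma ends_cons q ps : ends (q :: ps) = [:: q.1, q.2 & ends ps].
Proof. by []. Qed.

Lemma unzip2_cons (q : nat * nat) ps : unzip2 (q :: ps) = q.2 :: unzip2 ps.
Proof. by []. Qed.

(* In the notation of the header, U lists the variables of u, ps the pairs
   (a_i, b_i), b :: C is the set C, and p is the degree of w. *)
Definition witness n k p (U : seq nat) (ps : seq (nat * nat)) (b : nat) (C : seq nat) : Prop :=
  [/\ uniq (U ++ ends ps ++ b :: C) /\ all (fun i => i < n) (U ++ ends ps ++ b :: C),
      size ps + (size C).+1 = p,
      forall x y, x \in transversals ps -> y \in b :: C ->
        run_matching (mem (U ++ y :: x)) n k,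
      forall i, i \in b :: unzip2 ps ->
        ~ run_matching (fun j => (j \in U ++ b :: unzip2 ps) && (j != i)) n k
    & ~ run_matching (mem (U ++ b :: unzip2 ps)) n k.+1].

(** Here k disjoint runs must tile the whole interval, so the first one contains 0. *)
Lemma run_matching_start P k : 0 < k -> ~~ P 0 -> ~ run_matching P (k * t) k.
Proof.
move=> k_gt0 P0.
elim: k k_gt0 => //= k IHk _ [i [le_in Pi mi]].
have ik : i = k * t by have := run_matching_leq mi; move: le_in; rewrite mulSn; lia.
case: k {le_in} IHk mi ik => [|k] IHk mi ik; last by apply: IHk => //; rewrite -ik.
by move: P0; rewrite Pi // ik.
Qed.

(** The ideal is principal here, generated by the product of all variables; w is u e_b with b the
    vertex 0. *)
Lemma witness_runs k : 0 < k -> witness (k * t) k 1 (iota 1 (k * t).-1) [::] 0 [::].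
Proof.
move=> k_gt0; have kt_gt0 : 0 < k * t by rewrite muln_gt0 k_gt0.
split=> //.
- rewrite /= -[X in X ++ _]/(iota 1 _) cats1 rcons_uniq mem_iota iota_uniq; split=> //.
  apply/allP => i; rewrite mem_rcons inE mem_iota; lia.
- move=> x y; rewrite !inE => /eqP-> /eqP->.
  have all_in j : j < k * t -> j \in iota 1 (k * t).-1 ++ [:: 0].
    by rewrite mem_cat mem_iota inE; lia.
  move: all_in; move: {kt_gt0}(iota 1 _ ++ _) => s.
  elim: k {k_gt0} => //= k IHk all_in; exists (k * t); split=> [|j ij|].
  + by rewrite mulSn addnC.
  + by apply: all_in; rewrite mulSn; lia.
  + by apply: IHk => j jk; apply: all_in; rewrite mulSn; lia.
- move=> i; rewrite inE => /eqP->; apply: run_matching_start => //.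
  by rewrite eqxx andbF.
- by move=> /run_matching_leq; rewrite mulSn; lia.
Qed.

(** On the block d, ..., d+t the interior goes into u, and either end completes it to a run; the
    ends are b and the element of C. *)
Lemma witness_block d : d < t -> witness (d + t).+1 1 2 (iota d.+1 t.-1) [::] (d + t) [:: d].
Proof.
move=> dt; split=> //.
- rewrite /= uniq_catC /= !inE !mem_iota iota_uniq; split; first lia.
  by apply/allP => i; rewrite mem_cat mem_iota !inE; lia.
- move=> x y; rewrite !inE => /eqP-> /orP[]/eqP->.
    exists d.+1; split=> [|j ij|//]; first lia.
    by rewrite inE mem_cat mem_iota inE; lia.
  exists d; split=> [|j ij|//]; first lia.
  by rewrite inE mem_cat mem_iota inE; lia.
- move=> i; rewrite inE => /eqP-> /= [j [jn /[dup] H1]].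
  move=> /(_ j) H2 _; have H3 := H1 (j + t.-1); move: H2 H3.
  by rewrite !mem_cat !mem_iota !inE; lia.
- move=> /= [j [jn H1 [j' [jn' H2 _]]]].
  have {}H1 := H1 j; have {}H2 := H2 j'; move: H1 H2.
  by rewrite !inE !mem_cat !mem_iota !inE; lia.
Qed.

(** A new block puts its interior into U and both ends into C, raising the degree by two. Either end
    completes a run, while U and b alone gain none, because both ends are absent. *)
Lemma witness_add_base n p U b C : witness n 1 p U [::] b C ->
  witness (n + t).+1 1 p.+2 (U ++ iota n.+1 t.-1) [::] b [:: n, n + t & C].
Proof.
move=> [/= [Uu /allP Un] pE UC Ub Um].
have Lt i : i \in U ++ [:: b] -> i < n.
  by rewrite mem_cat inE => iU; apply: Un; rewrite mem_cat !inE orbA iU.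
split=> //.
- split.
    rewrite (@perm_uniq _ _ ((iota n.+1 t.-1 ++ [:: n; n + t]) ++ U ++ b :: C)).
      rewrite cat_uniq Uu andbT; apply/andP; split.
        rewrite uniq_catC /= !inE !mem_iota iota_uniq; lia.
      apply/hasPn => i /Un; rewrite !(mem_cat, inE) mem_iota; lia.
    by apply/permP => a; rewrite !count_cat /= ?count_cat /=; lia.
  apply/allP => i; rewrite !(mem_cat, inE) mem_iota -!orbA => H.
  have {H} : (i \in U ++ b :: C) || (n <= i < (n + t).+1).
    by rewrite !(mem_cat, inE); move: H; case: (i \in U); case: (i \in C) => //=; lia.
  by case/orP => [/Un|]; lia.
- by rewrite /= -pE.
- move=> x y; rewrite inE => /eqP-> /=.
  have old z : z \in b :: C -> run_matching (mem ((U ++ iota n.+1 t.-1) ++ [:: z])) (n + t).+1 1.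
    move=> zC; have := UC [::] z (mem_head _ _) zC; apply: run_matching_mono; last lia.
    by move=> j _; rewrite !(inE, mem_cat) => /orP[] ->; rewrite ?orbT.
  rewrite !inE => /or4P[/eqP->|/eqP->|/eqP->|yC].
  + by apply: old; rewrite mem_head.
  + exists n; split=> [|j ij|//]; first lia.
    by rewrite !(inE, mem_cat) mem_iota; lia.
  + exists n.+1; split=> [|j ij|//]; first lia.
    by rewrite !(inE, mem_cat) mem_iota; lia.
  + by apply: old; rewrite inE yC orbT.
- move=> i iE /run_matching_gap2 H; apply: (Ub _ iE); apply: (run_matching_mono _ _ (H _ _)) => //.
  + by move=> j jn; rewrite !(mem_cat, inE) mem_iota /=; lia.
  + have := Lt n; rewrite !(mem_cat, inE) mem_iota; lia.
  + have := Lt (n + t); rewrite !(mem_cat, inE) mem_iota; lia.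
- move=> /run_matching_gap2 H; apply: Um; apply: (run_matching_mono _ _ (H _ _)) => //.
  + by move=> j jn; rewrite !(mem_cat, inE) mem_iota /=; lia.
  + have := Lt n; rewrite !(mem_cat, inE) mem_iota; lia.
  + have := Lt (n + t); rewrite !(mem_cat, inE) mem_iota; lia.
Qed.

(** A new block whose ends form a pair (a_i, b_i) raises k and the degree by one: either end
    completes one more run, and without n the block holds no second one. *)
Lemma witness_add_pair n k p U ps b C : witness n k p U ps b C ->
  witness (n + t).+1 k.+1 p.+1 (U ++ iota n.+1 t.-1) ((n, n + t) :: ps) b C.
Proof.
move=> [[Uu /allP Un] pE UC Ub Um].
have ends2 i : i \in unzip2 ps -> i \in ends ps.
  by case/mapP => q qps ->; apply/flattenP; exists [:: q.1; q.2]; rewrite ?map_f // !inE eqxx orbT.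
have Lt i : i \in U ++ b :: unzip2 ps -> i < n.
  rewrite mem_cat inE => iU; apply: Un; move: iU; rewrite !(mem_cat, inE).
  by case/or3P => [->|->|/ends2 ->]; rewrite ?orbT.
split=> //.
- split.
    rewrite (@perm_uniq _ _ ((iota n.+1 t.-1 ++ [:: n; n + t]) ++ U ++ ends ps ++ b :: C)).
      rewrite cat_uniq Uu andbT; apply/andP; split.
        rewrite uniq_catC /= !inE !mem_iota iota_uniq; lia.
      apply/hasPn => i /Un; rewrite !(mem_cat, inE) mem_iota; lia.
    by apply/permP => a; rewrite ends_cons !count_cat /= ?count_cat /=; lia.
  apply/allP => i; rewrite ends_cons !(mem_cat, inE) mem_iota => H.
  have {H} : (i \in U ++ ends ps ++ b :: C) || (n <= i < (n + t).+1).
    rewrite !(mem_cat, inE); move: H.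
    by case: (i \in U); case: (i \in C); case: (i \in ends ps) => //=; lia.
  by case/orP => [/Un|]; lia.
- by rewrite /= -pE.
- move=> x y; rewrite mem_cat => H yC.
  have {H}[c [x' [xE x'ps cE]]] : exists c x',
      [/\ x = c :: x', x' \in transversals ps & c = n \/ c = n + t].
    case/orP: H => /mapP[x' x'ps ->]; first by exists n, x'; split=> //; left.
    by exists (n + t), x'; split=> //; right.
  have [i [iE1 iE2 iE3]] : exists i, [/\ n <= i, i <= n.+1 &
      forall j, i <= j < i + t -> j = c \/ n.+1 <= j < n + t].
    by case: cE => ->; [exists n | exists n.+1]; split=> // j; lia.
  exists i; split=> [|j /iE3|]; first lia.
    by rewrite !(mem_cat, inE) mem_iota xE inE => -[->|jE]; [rewrite eqxx !orbT | lia].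
  have := UC x' y x'ps yC; apply: run_matching_mono => // j _.
  by rewrite xE !(mem_cat, inE) => /or3P[]->; rewrite ?orbT.
- move=> i; rewrite !inE => /or3P[iE|/eqP iE|iE].
  + have ib : i \in b :: unzip2 ps by rewrite inE iE.
    move=> /run_matching_gap H; apply: (Ub i ib); apply: (run_matching_mono _ _ (H _)) => //.
      by move=> j jn; rewrite unzip2_cons !(mem_cat, inE) mem_iota /=; lia.
    by have := Lt n; rewrite unzip2_cons !(mem_cat, inE) mem_iota /=; lia.
  + move=> /run_matching_gap2 H; apply: Um; apply: (run_matching_mono _ _ (H _ _)) => //.
    * by move=> j jn; rewrite unzip2_cons !(mem_cat, inE) mem_iota /=; lia.
    * by have := Lt n; rewrite unzip2_cons !(mem_cat, inE) mem_iota /=; lia.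
    * by rewrite iE eqxx andbF.
  + have ib : i \in b :: unzip2 ps by rewrite inE iE orbT.
    move=> /run_matching_gap H; apply: (Ub i ib); apply: (run_matching_mono _ _ (H _)) => //.
      by move=> j jn; rewrite unzip2_cons !(mem_cat, inE) mem_iota /=; lia.
    by have := Lt n; rewrite unzip2_cons !(mem_cat, inE) mem_iota /=; lia.
- move=> /run_matching_gap H; apply: Um; apply: (run_matching_mono _ _ (H _)) => //.
    by move=> j jn; rewrite unzip2_cons !(mem_cat, inE) mem_iota /=; lia.
  by have := Lt n; rewrite unzip2_cons !(mem_cat, inE) mem_iota /=; lia.
Qed.

End RunMatchings.

(** * Monomial ideals *)

Lemma ideal_sum (R : comNzRingType) (W : submodClosed (R^o : lmodType R)) (I : eqType)
    (r : seq I) (a b : I -> R) :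
  (forall i, i \in r -> (b i : R^o) \in W) -> (\sum_(i <- r) a i * b i : R^o) \in W.
Proof.
elim: r => [|i r IHr] bW; first by rewrite big_nil; exact: (rpred0 W).
rewrite big_cons; apply: (@rpredD _ W); last by apply: IHr => j jr; apply: bW; rewrite inE jr orbT.
by apply: (@rpredZ _ _ W (a i) (b i)); apply: bW; rewrite mem_head.
Qed.

Section MonomialIdeals.
Variables (K : fieldType) (n : nat).
Local Notation R := {mpoly K[n]}.
Implicit Types (m : 'X_{1..n}) (f g : R) (l : seq nat) (Q : 'X_{1..n} -> Prop).

Definition monomial_ideal Q : {pred R^o} := fun f =>
  `[< forall m, m \in msupp f -> exists2 m0, Q m0 & (m0 <= m)%MM >].

Lemma monomial_idealP Q f : reflect
  (forall m, m \in msupp f -> exists2 m0, Q m0 & (m0 <= m)%MM) (f \in monomial_ideal Q).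
Proof. exact: asboolP. Qed.

Lemma monomial_ideal_submod_closed Q : submod_closed (monomial_ideal Q).
Proof.
split=> [|a u v /monomial_idealP uQ /monomial_idealP vQ].
  by apply/monomial_idealP => m; rewrite msupp0.
apply/monomial_idealP => m /msuppD_le; rewrite mem_cat => /orP[|/vQ//].
move=> /msuppM_le/allpairsP[[m1 m2] /= [_ /uQ[m0 Q0 le_m0] ->]].
by exists m0 => //; apply: lepm_trans le_m0 (lem_addl _ _).
Qed.

HB.instance Definition _ Q :=
  GRing.isSubmodClosed.Build R R^o (monomial_ideal Q) (monomial_ideal_submod_closed Q).

Lemma monomial_ideal_split Q1 Q2 f :
    (forall m, m \in msupp f -> Q1 m \/ Q2 m) ->
  exists f1 f2, [/\ f = f1 + f2, forall m, m \in msupp f1 -> Q1 m &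
    forall m, m \in msupp f2 -> Q2 m].
Proof.
have msupp_sum (s : seq 'X_{1..n}) m : m \in msupp (\sum_(m' <- s) f@_m' *: 'X_[m']) -> m \in s.
  elim: s => [|m' s IHs]; first by rewrite big_nil msupp0.
  rewrite big_cons => /msuppD_le; rewrite mem_cat inE => /orP[/msuppZ_le|/IHs ->]; last by rewrite orbT.
  by rewrite msuppX inE => ->.
move=> fQ; pose p m := `[< Q1 m >].
exists (\sum_(m <- [seq m <- msupp f | p m]) f@_m *: 'X_[m]),
  (\sum_(m <- [seq m <- msupp f | ~~ p m]) f@_m *: 'X_[m]); split.
- by rewrite {1}[f]mpolyE (bigID p) /= !big_filter.
- by move=> m /msupp_sum; rewrite mem_filter => /andP[/asboolP].
- by move=> m /msupp_sum; rewrite mem_filter => /andP[/asboolP ? /fQ[]].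
Qed.

(** A predicate on natural numbers, false from n on, so that it can be fed to [run_matching]. *)
Definition supp m : pred nat := fun i => [exists j : 'I_n, (j == i :> nat) && (0 < m j)%N].

Lemma suppE m (j : 'I_n) : supp m j = (0 < m j)%N.
Proof.
apply/existsP/idP => [[i /andP[/eqP/val_inj -> //]]|mj].
by exists j; rewrite eqxx.
Qed.

Lemma supp_lt m i : supp m i -> (i < n)%N.
Proof. by case/existsP => j /andP[/eqP <-]. Qed.

Lemma supp_le m m' i : (m <= m')%MM -> supp m i -> supp m' i.
Proof.
move=> /mnm_lepP le_m /existsP[j /andP[ji mj]].
by apply/existsP; exists j; rewrite ji (leq_trans mj).
Qed.

Lemma suppD m m' i : supp (m + m')%MM i = supp m i || supp m' i.
Proof.
apply/existsP/orP => [[j /andP[ji]]|[]/existsP[j /andP[ji mj]]].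
- rewrite mnmDE addn_gt0 => /orP[] mj; [left|right];
    by apply/existsP; exists j; rewrite ji mj.
- by exists j; rewrite ji mnmDE addn_gt0 mj.
- by exists j; rewrite ji mnmDE addn_gt0 mj orbT.
Qed.

Definition mlist l : 'X_{1..n} := [multinom count_mem (j : nat) l | j < n].

Lemma mlist_cat l l' : mlist (l ++ l') = (mlist l + mlist l')%MM.
Proof. by apply/mnmP => j; rewrite mnmDE !mnmE count_cat. Qed.

Lemma supp_mlist l i : supp (mlist l) i = (i < n)%N && (i \in l).
Proof.
apply/idP/andP => [|[lt_in il]].
  by move=> /[dup] /supp_lt -> /existsP[j /andP[/eqP <-]]; rewrite mnmE -has_count has_pred1.
by rewrite -[i]/(val (Ordinal lt_in)) suppE mnmE -has_count has_pred1.
Qed.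

Lemma mlist_le l m : uniq l -> (forall i, i \in l -> (i < n)%N -> supp m i) -> (mlist l <= m)%MM.
Proof.
move=> Ul lm; apply/mnm_lepP => j; rewrite mnmE count_uniq_mem //.
by case: (boolP (val j \in l)) => // /lm/(_ (ltn_ord j)); rewrite suppE.
Qed.

Lemma mdeg_mlist l : all (fun i => i < n)%N l -> mdeg (mlist l) = size l.
Proof.
move=> /allP ln; rewrite mdegE (eq_bigr (fun j : 'I_n => \sum_(i <- l | i == j) 1)%N); last first.
  by move=> j _; rewrite mnmE sum1_count; apply: eq_count => i; rewrite inE.
rewrite (exchange_big_dep xpredT) //= -sum1_size big_seq [RHS]big_seq.
apply: eq_bigr => i /ln lt_in; by rewrite (big_pred1 (Ordinal lt_in)).
Qed.

Lemma mdeg_le_eq m m' : (m <= m')%MM -> (mdeg m' <= mdeg m)%N -> m = m'.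
Proof.
move=> le_m; rewrite -(submK le_m) mdegD -[X in (_ <= X)%N]add0n leq_add2r leqn0 mdeg_eq0.
by move/eqP => ->; rewrite add0m.
Qed.

Lemma mpolyX_mlist l : 'X_[mlist l] = \prod_(i <- l) 'X_[mlist [:: i]] :> R.
Proof.
elim: l => [|i l IHl]; last by rewrite big_cons -cat1s mlist_cat mpolyXD IHl.
by rewrite big_nil (_ : mlist [::] = 0%MM) ?mpolyX0.
Qed.

End MonomialIdeals.

(** * Squarefree powers of the path ideal through disjoint runs *)

Section SquarefreePowerOfPathIdeal.
Variables (K : fieldType) (n t : nat).
Hypothesis t_gt0 : (0 < t)%N.
Local Notation R := {mpoly K[n]}.
Implicit Types (m : 'X_{1..n}) (f g : R) (l s : seq nat).

Definition runs (s : seq nat) : seq nat := flatten [seq iota i t | i <- s].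

Lemma size_runs s : size (runs s) = (size s * t)%N.
Proof. by elim: s => //= i s IHs; rewrite size_cat size_iota IHs mulSn. Qed.

Lemma run_matching_runs (P : pred nat) N k : run_matching t P N k ->
  exists s, [/\ size s = k, all (fun i => i + t <= N)%N s, uniq (runs s) & all P (runs s)].
Proof.
elim: k N => [|k IHk] N; first by exists [::].
case=> i [le_iN Pi /IHk[s [sk sN Us Ps]]]; exists (i :: s); rewrite /= sk le_iN; split=> //.
- by apply: sub_all sN => j /leq_trans; apply; rewrite (leq_trans _ le_iN) ?leq_addr.
- rewrite cat_uniq iota_uniq Us andbT /=; apply/hasPn => j /flattenP[_ /mapP[q qs ->]].
  by move/(allP sN): qs; rewrite !mem_iota; lia.
- rewrite all_cat Ps andbT; apply/allP => j; rewrite mem_iota; exact: Pi.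
Qed.

Lemma seq_max s : s != [::] -> exists2 i, i \in s & forall j, j \in s -> (j <= i)%N.
Proof.
elim: s => // a [_ _|b s IHs _].
  by exists a => [|j]; rewrite inE // => /eqP->.
have [//|i is_ i_max] := IHs; case: (leqP a i) => [le_ai|lt_ia].
  by exists i => [|j]; rewrite in_cons ?is_ ?orbT // => /predU1P[->//|/i_max].
exists a => [|j]; rewrite in_cons ?eqxx // => /predU1P[->//|/i_max le_ji].
exact: leq_trans le_ji (ltnW lt_ia).
Qed.

Lemma runs_run_matching (P : pred nat) N s : all (fun i => i + t <= N)%N s ->
  uniq (runs s) -> all P (runs s) -> run_matching t P N (size s).
Proof.
move Ek: (size s) => k; elim: k N s Ek => [//|k IHk] N s sk sN Us Ps.
have [i is_ i_max] : exists2 i, i \in s & forall j, j \in s -> (j <= i)%N.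
  by apply: seq_max; rewrite -size_eq0 sk.
have permE : perm_eq (runs s) (runs (i :: rem i s)).
  by apply: perm_flatten; apply: perm_map; apply: perm_to_rem.
have sE j : (j \in s) = (j \in i :: rem i s) by apply: perm_mem; apply: perm_to_rem.
move: Us Ps; rewrite (perm_uniq permE) (perm_all _ permE) /= cat_uniq all_cat.
move=> /and3P[_ /hasPn disj Us] /andP[Pi Ps]; exists i; split.
- exact: (allP sN).
- by move=> j ij; apply: (allP Pi); rewrite mem_iota.
- apply: (IHk i (rem i s)) => //; first by rewrite size_rem // sk.
  (* The run of largest start i comes last: a run starting at j <= i and reaching beyond i would
     contain i. *)
  apply/allP => j js; rewrite leqNgt; apply/negP => lt_ij.
  have le_ji : (j <= i)%N by apply: i_max; rewrite sE inE js orbT.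
  have : i \in runs (rem i s).
    by apply/flattenP; exists (iota j t); [apply: map_f | rewrite mem_iota; lia].
  by move/disj; rewrite !mem_iota; lia.
Qed.

Definition run_ideal (N k : nat) : {pred R^o} :=
  @monomial_ideal K n (fun m => run_matching t (supp m) N k).

Lemma run_idealP N k f : reflect
  (forall m, m \in msupp f -> run_matching t (supp m) N k) (f \in run_ideal N k).
Proof.
apply: (iffP (monomial_idealP _ _)) => fP m /fP; last by exists m => //; exact: lepm_refl.
case=> m0 H le_m0; apply: (run_matching_mono _ (leqnn N) H) => j _.
exact: supp_le.
Qed.

(* Unlike in run_matching, the runs may overlap. *)
Definition run_product k m : Prop :=
  exists s, [/\ size s = k, all (fun i => i + t <= n)%N s & (mlist n (runs s) <= m)%MM].

Lemma facet_prod (i : 'I_n) :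
  \prod_(j in [set j : 'I_n | (i <= j < i + t)%N]) 'X_j = 'X_[mlist n (iota i t)] :> R.
Proof.
rewrite mpolyXE_id big_mkcond; apply: eq_bigr => j _.
by rewrite mnmE count_uniq_mem ?iota_uniq // mem_iota inE; case: ifP.
Qed.

Lemma path_ideal_run (i : nat) : (i + t <= n)%N -> 'X_[mlist n (iota i t)] \in path_ideal K n t.
Proof.
move=> itn; have lt_in : (i < n)%N by lia.
apply/asboolP; exists [:: (1, 'X_[mlist n (iota i t)])]; split; last by rewrite big_seq1 mul1r.
move=> c; rewrite inE => /eqP-> /=.
exists [set j : 'I_n | (Ordinal lt_in <= j < Ordinal lt_in + t)%N].
  by apply/imsetP; exists (Ordinal lt_in); rewrite ?inE.
by rewrite facet_prod.
Qed.

Lemma path_ideal_sub f : f \in path_ideal K n t -> f \in monomial_ideal (run_product 1).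
Proof.
move=> /asboolP[s [sG ->]]; apply: (@ideal_sum _ (monomial_ideal _)) => c cs.
have [F /imsetP[i]] := sG c cs.
rewrite inE => itn -> ->; rewrite facet_prod; apply/monomial_idealP => m; rewrite msuppX inE => /eqP->.
exists (mlist n (iota i t)); last exact: lepm_refl.
by exists [:: val i]; rewrite /= itn /runs /= cats0; split=> //; exact: lepm_refl.
Qed.

Lemma ideal_power_sub k f : f \in ideal_power (path_ideal K n t) k ->
  f \in monomial_ideal (run_product k).
Proof.
move=> /asboolP[s [sG ->]]; apply: (@ideal_sum _ (monomial_ideal _)) => c cs.
have [h [hI ->]] := sG c cs.
elim: k h hI {sG cs} => [|k IHk] h hI.
  rewrite big_ord0; apply/monomial_idealP => m _.
  exists m; last exact: lepm_refl.
  by exists [::]; split=> //; apply/mnm_lepP => j; rewrite mnmE.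
rewrite big_ord_recl; apply/monomial_idealP => m /msuppM_le/allpairsP[[m1 m2] /= [H1 H2 ->]].
have /monomial_idealP/(_ _ H1)[m1' [s1 [s1k s1n s1m]] le1] := path_ideal_sub (hI ord0).
have /monomial_idealP/(_ _ H2)[m2' [s2 [s2k s2n s2m]] le2] :=
  IHk (fun i => h (lift ord0 i)) (fun i => hI _).
exists (m1' + m2')%MM.
  exists (s1 ++ s2); rewrite size_cat s1k s2k all_cat s1n s2n; split=> //.
  rewrite /runs map_cat flatten_cat mlist_cat; apply/mnm_lepP => j.
  by rewrite !mnmDE leq_add // ?(mnm_lepP s1m) ?(mnm_lepP s2m).
by apply/mnm_lepP => j; rewrite !mnmDE leq_add // ?(mnm_lepP le1) ?(mnm_lepP le2).
Qed.

Lemma runs_lt s : all (fun i => i + t <= n)%N s -> all (fun i => i < n)%N (runs s).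
Proof.
move=> /allP sn; apply/allP => j /flattenP[_ /mapP[i /sn itn ->]].
by rewrite mem_iota; lia.
Qed.

(** Minimality is a degree count: every monomial of the k-th power is divisible by a product of k
    runs, of degree k t, which is already the degree of the given monomial. *)
Lemma squarefree_power_gen_runs s : all (fun i => i + t <= n)%N s -> uniq (runs s) ->
  squarefree_power_gens (path_ideal K n t) (size s) 'X_[mlist n (runs s)].
Proof.
move=> sn Us; exists (mlist n (runs s)); split=> //; last first.
  by move=> i; rewrite mnmE count_uniq_mem // leq_b1.
split.
  apply/asboolP; exists [:: (1, 'X_[mlist n (runs s)])]; split; last by rewrite big_seq1 mul1r.
  move=> c; rewrite inE => /eqP-> /=.
  exists (fun i : 'I_(size s) => 'X_[mlist n (iota (nth 0%N s i) t)]); split.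
    by move=> i; apply: path_ideal_run; apply: (allP sn); rewrite mem_nth.
  rewrite mpolyX_mlist /runs big_flatten big_map (big_nth 0%N) big_mkord.
  by apply: eq_bigr => i _; rewrite -mpolyX_mlist.
move=> m' /ideal_power_sub/monomial_idealP/(_ m'); rewrite msuppX mem_head => /(_ isT).
case=> m0 [s' [s's s'n le1]] le2 le3; apply: mdeg_le_eq => //.
rewrite (mdeg_mlist (runs_lt sn)) size_runs -s's -size_runs -(mdeg_mlist (runs_lt s'n)).
have := lepm_trans le1 le2 => le4; rewrite -(submK le4) mdegD; exact: leq_addl.
Qed.

(** A generator is divisible by a product of k runs, and squarefreeness makes them disjoint.
    Conversely each monomial of f is a multiple of a product of k disjoint runs. *)
Lemma squarefree_powerE k f :
  (f \in squarefree_power (path_ideal K n t) k) = (f \in run_ideal n k).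
Proof.
apply/idP/run_idealP => [/asboolP[s [sG ->]]|fP].
  suff /run_idealP : (\sum_(c <- s) c.1 * c.2 : R^o) \in run_ideal n k by [].
  apply: (@ideal_sum _ (monomial_ideal _)) => c cs.
  have [m [[mI _] msq ->]] := sG c cs.
  apply/run_idealP => m'; rewrite msuppX inE => /eqP->.
  have /monomial_idealP/(_ m) := ideal_power_sub mI.
  rewrite msuppX mem_head => /(_ isT)[m0 [r [<- rn le1]] /(lepm_trans le1) /mnm_lepP le2].
  have le_m x (lt_xn : (x < n)%N) : (count_mem x (runs r) <= m (Ordinal lt_xn))%N.
    by have := le2 (Ordinal lt_xn); rewrite mnmE.
  apply: runs_run_matching => //.
    apply: count_mem_uniq => x; case: (boolP (x \in runs r)) => [xr|/count_memPn //].
    apply/eqP; rewrite eqn_leq -has_count has_pred1 xr andbT.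
    by have lt_xn := allP (runs_lt rn) x xr; apply: leq_trans (le_m x lt_xn) (msq _).
  apply/allP => x xr; have lt_xn := allP (runs_lt rn) x xr.
  rewrite -[x]/(val (Ordinal lt_xn)) suppE; apply: leq_trans (le_m x lt_xn).
  by rewrite -has_count has_pred1.
rewrite [f]mpolyE (eq_bigr _ (fun m _ => esym (mul_mpolyC (f@_m) 'X_[m]))).
apply: (@ideal_sum _ (squarefree_power _ _)) => m /fP/run_matching_runs[s [<- sn Us Ps]].
have le_m : (mlist n (runs s) <= m)%MM.
  by apply: mlist_le => // i /(allP Ps).
apply/asboolP; exists [:: ('X_[m - mlist n (runs s)], 'X_[mlist n (runs s)])].
split=> [c|]; last by rewrite big_seq1 -mpolyXD submK.
by rewrite inE => /eqP-> /=; apply: squarefree_power_gen_runs.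
Qed.

End SquarefreePowerOfPathIdeal.

(** * The lower bound *)

Section PathLowerBound.
Variables (K : fieldType) (n : nat).
Local Notation R := {mpoly K[n]}.
Implicit Types (m : 'X_{1..n}) (f g : R) (l : seq nat).

Lemma mpolyX_divide (mu : 'X_{1..n}) f : (forall m, m \in msupp f -> (mu <= m)%MM) ->
  exists2 g, f = 'X_[mu] * g & forall m, m \in msupp g -> (mu + m)%MM \in msupp f.
Proof.
move=> le_mu; pose g := \sum_(m <- msupp f) f@_m *: 'X_[K, (m - mu)%MM].
have fE : f = 'X_[mu] * g.
  rewrite {1}[f]mpolyE mulr_sumr big_seq [RHS]big_seq; apply: eq_bigr => m /le_mu le_m.
  by rewrite -scalerAr -mpolyXD addmC submK.
by clearbody g; exists g => // m; rewrite fE !mcoeff_msupp mulrC mcoeffMX.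
Qed.

Definition pathvar (i : nat) : R := 'X_[mlist n [:: i]].

Lemma in_span_pathvar l f : all (fun i => i < n)%N l ->
  in_span (map pathvar l) (f : R^o) <->
    forall m, m \in msupp f -> exists2 i, i \in l & supp m i.
Proof.
elim: l f => [|i l IHl] f /=.
  move=> _; split=> [-> m|fl]; first by rewrite msupp0.
  by apply/eqP; rewrite -msupp_eq0; case: (msupp f) fl => // m s /(_ m (mem_head _ _))[].
case/andP=> i_lt l_lt; split=> [[f1 [f' [-> /(IHl _ l_lt) f'l]]] m|fl].
  move=> /msuppD_le; rewrite mem_cat => /orP[|/f'l[j jl mj]]; last first.
    by exists j; rewrite // inE jl orbT.
  rewrite [_ *: _]mulrC => /msuppM_le/allpairsP[[m1 m2] /= [_ + ->]].
  rewrite msuppX inE => /eqP->; exists i; rewrite ?mem_head //.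
  by rewrite suppD supp_mlist i_lt mem_head orbT.
have [f1 [f2 [-> f1i f2l]]] : exists f1 f2, [/\ f = f1 + f2,
    forall m, m \in msupp f1 -> supp m i &
    forall m, m \in msupp f2 -> exists2 j, j \in l & supp m j].
  apply: monomial_ideal_split => m /fl[j]; rewrite inE => /predU1P[->|jl] mj; first by left.
  by right; exists j.
have [|g -> _] := @mpolyX_divide (mlist n [:: i]) f1.
  move=> m /f1i mi; apply: mlist_le => // j; rewrite inE => /eqP-> //.
by exists g, f2; split=> //; apply/IHl.
Qed.

(** Multiplication by x_i brings none of the other variables into a monomial. *)
Lemma regular_pathvar l : uniq l -> all (fun i => i < n)%N l ->
  regular_on (map pathvar l) (R^o : lmodType R).
Proof.
elim: l => //= i l IHl /andP[i_l Ul] /andP[i_lt l_lt]; split; last exact: IHl.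
move=> f /(in_span_pathvar _ l_lt) fl; apply/in_span_pathvar => // m mf.
have [|j jl] := fl (mlist n [:: i] + m)%MM.
  by rewrite mcoeff_msupp [_ *: _]mulrC mcoeffMX -mcoeff_msupp.
rewrite suppD supp_mlist inE => /orP[/andP[_ /eqP ji]|mj]; last by exists j.
by rewrite -ji jl in i_l.
Qed.

Variable t : nat.
Hypothesis t_gt0 : (0 < t)%N.

Lemma path_lower_bound k p U ps b C h : witness t n k p U ps b C ->
    has_projective_resolution
      (quotient_module (squarefree_power (path_ideal K n t) k)) h ->
  (p <= h)%N.
Proof.
move=> [[Un ltn_] pE UC Ub Um] res; rewrite -pE.
pose ps' := [seq (pathvar q.1, pathvar q.2) | q <- ps].
have XE s : \prod_(i <- s) pathvar i = 'X_[mlist n s] by rewrite mpolyX_mlist.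
have seqE : bracket_seq ps' (pathvar b :: map pathvar C) = map pathvar (ends ps ++ b :: C).
  by rewrite /ps'; elim: (ps) => //= q qs ->.
have transE : transversal_prods ps' =
    [seq \prod_(i <- x) pathvar i | x <- transversals ps].
  rewrite /ps'; elim: (ps) => [|q qs IHqs] /=; first by rewrite big_nil.
  by rewrite IHqs map_cat -!map_comp; congr (_ ++ _); apply: eq_map => x; rewrite /= big_cons.
pose L := U ++ b :: unzip2 ps.
have UL : uniq L.
  have sub : subseq (U ++ unzip2 ps ++ [:: b]) (U ++ ends ps ++ b :: C).
    rewrite cat_subseq // cat_subseq ?sub1seq ?mem_head //.
    elim: (ps) => // q qs IHqs.
    by apply: (@cat_subseq _ [:: q.2] _ [:: q.1; q.2]) => //; rewrite sub1seq !inE eqxx orbT.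
  have := subseq_uniq sub Un; rewrite (@perm_uniq _ _ L) //.
  by rewrite perm_cat2l -[b :: _]cat1s perm_catC.
have subL i : i \in L -> (i < n)%N.
  move=> iL; apply: (allP ltn_); move: iL; rewrite !(mem_cat, inE).
  case/or3P => [->|->|]; rewrite ?orbT //.
  case/mapP => q qps ->; apply/orP; right; apply/orP; left.
  by apply/flattenP; exists [:: q.1; q.2]; rewrite ?map_f // !inE eqxx orbT.
have sz : size ps = size ps' by rewrite size_map.
(* The functional [phi] is the coefficient of the squarefree monomial on [L], which is u b times the
   product of the b_i. *)
rewrite sz -(size_map pathvar C).
apply: (koszul_lower_bound (phi := mcoeff (mlist n L)) (u := 'X_[mlist n U])
  (b0 := pathvar b) _ _ _ _ res).
- rewrite seqE; apply: regular_pathvar.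
    by move: Un; rewrite cat_uniq => /and3P[].
  by move: ltn_; rewrite all_cat => /andP[].
- move=> x y; rewrite transE -map_cons => /mapP[x' x's ->] /mapP[y' y's ->].
  rewrite squarefree_powerE //; apply/run_idealP => m.
  rewrite XE /pathvar -!mpolyXD -!mlist_cat msuppX inE => /eqP->.
  apply: (run_matching_mono _ (leqnn n) (UC _ _ x's y's)) => j jn.
  by rewrite supp_mlist jn !inE !(mem_cat, inE) => /or3P[]->; rewrite ?orbT.
- move=> b' x; have -> : map snd ps' = map pathvar (unzip2 ps) by rewrite -!map_comp.
  rewrite -map_cons => /mapP[i iL ->]; rewrite squarefree_powerE // => /run_idealP xI.
  have iL' : i \in L by rewrite mem_cat iL orbT.
  (* The coefficient of x_i x at [L] is that of x at [L] without i, whose support has no k disjoint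
     runs. *)
  have -> : mlist n L = (mlist n [:: i] + mlist n (rem i L))%MM.
    rewrite -mlist_cat; apply/mnmP => j; rewrite !mnmE.
    by apply/permP; apply: perm_to_rem.
  rewrite /= mulrC mcoeffMX; apply/eqP; rewrite mcoeff_eq0; apply/negP => /xI.
  move=> /run_matching_mono H; apply: (Ub i iL); apply: H => // j jn.
  by rewrite supp_mlist jn /= mem_rem_uniq // inE andbC.
- rewrite /ps' big_map (_ : \prod_(q <- ps) _ = 'X_[mlist n (unzip2 ps)]); last first.
    by rewrite -XE big_map.
  rewrite -!mpolyXD -!mlist_cat /= mcoeffX (_ : mlist _ _ = mlist n L) ?eqxx ?oner_eq0 //.
  apply/mnmP => j; rewrite !mnmE !count_cat /=; lia.
Qed.

End PathLowerBound.

(** * The upper bound *)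

Section PdBound.
Variable t : nat.
Local Open Scope nat_scope.

(** The strict bound for the ideal A(N,k), hence the value for its quotient ring. For k = 0 the
    ideal is the whole ring; for k > 0 and N < kt it is zero and truncated subtraction gives 0. *)
Definition pd_bound N k : nat :=
  if k == 0 then 1 else
  if N <= k * t.+1 then k.+1 - (k * t.+1 - N)
  else (2 * (N %/ t.+1) - k).+1 + (N %% t.+1 == t).

Lemma pd_bound_small N k : 0 < k -> N <= k * t.+1 ->
  pd_bound N k = k.+1 - (k * t.+1 - N).
Proof. by rewrite /pd_bound => /lt0n_neq0/negbTE-> ->. Qed.

Lemma pd_bound_large q r k : 0 < k -> r <= t -> k * t.+1 < q * t.+1 + r ->
  k <= q /\ pd_bound (q * t.+1 + r) k = (2 * q - k).+1 + (r == t).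
Proof.
move=> k_gt0 le_rt lt_k; split.
  rewrite leqNgt; apply/negP => lt_qk.
  have : q.+1 * t.+1 <= k * t.+1 by rewrite leq_mul2r lt_qk orbT.
  by rewrite mulSn; lia.
rewrite /pd_bound (negbTE (lt0n_neq0 k_gt0)) leqNgt lt_k /=.
by rewrite divnMDl // modnMDl modn_small // divn_small // addn0.
Qed.

Lemma pd_boundP N k : 0 < k ->
  (N <= k * t.+1 /\ pd_bound N k = k.+1 - (k * t.+1 - N)) \/
  exists q r, [/\ N = q * t.+1 + r, r <= t, k <= q, k * t.+1 < N &
    pd_bound N k = (2 * q - k).+1 + (r == t)].
Proof.
move=> k_gt0; case: (leqP N (k * t.+1)) => [le_N|lt_N].
  by left; rewrite pd_bound_small.
right; exists (N %/ t.+1), (N %% t.+1); have := divn_eq N t.+1 => NE.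
have le_r : N %% t.+1 <= t by rewrite -ltnS ltn_mod.
have [|le_k bE] := @pd_bound_large (N %/ t.+1) (N %% t.+1) k k_gt0 le_r; first by rewrite -NE.
by split=> //; rewrite -bE -NE.
Qed.

Lemma divmod_uniq q r q' r' : r <= t -> r' <= t ->
  q * t.+1 + r = q' * t.+1 + r' -> q = q' /\ r = r'.
Proof.
move=> le_r le_r' E.
have Eq : q = q'.
  have := congr1 (fun x => x %/ t.+1) E.
  by rewrite /= !divnMDl // !divn_small // !addn0.
by split=> //; move: E; rewrite Eq => /addnI.
Qed.

Hypothesis t_gt0 : 0 < t.

Lemma pd_bound_gt0 N k : k * t <= N -> 0 < pd_bound N k.
Proof.
case: k => // k le_N; case: (@pd_boundP N k.+1) => // [[le_N' ->]|[q [r [_ _ _ _ ->]]]] //.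
by move: le_N le_N'; rewrite !mulSn mulnS; lia.
Qed.

Lemma pd_bound_le_prev N k : 0 < N -> pd_bound N.-1 k.+1 <= pd_bound N k.+1.
Proof.
move=> N_gt0.
case: (@pd_boundP N.-1 k.+1) => // [[le1 ->]|[q1 [r1 [E1 le1 kq1 lt1 ->]]]];
case: (@pd_boundP N k.+1) => // [[le2 ->]|[q2 [r2 [E2 le2 kq2 lt2 ->]]]]; try lia.
(* If N-1 has remainder t, then N starts the next quotient with remainder 0. *)
case: (leqP t r1) => r1t.
  have [//||-> ->] := @divmod_uniq q2 r2 q1.+1 0 le2; first by rewrite mulSn; lia.
  by lia.
have [|-> ->] := @divmod_uniq q2 r2 q1 r1.+1 le2 r1t; lia.
Qed.

Lemma pd_bound_le_run N k : t <= N -> k.+1 * t <= N -> pd_bound (N - t) k <= pd_bound N k.+1.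
Proof.
move=> le_tN kN.
case: k kN => [|k] kN; first by apply: pd_bound_gt0.
case: (@pd_boundP (N - t) k.+1) => // [[le1 ->]|[q1 [r1 [E1 le1 kq1 lt1 ->]]]];
case: (@pd_boundP N k.+2) => // [[le2 ->]|[q2 [r2 [E2 le2 kq2 lt2 ->]]]].
- by move: le1 le2; rewrite !mulSn; lia.
- by move: le1 le2 lt2; rewrite !mulSn; lia.
- have NE : N - t = k.+1 * t.+1 + 1 by move: lt1 le2; rewrite !mulSn; lia.
  have [|-> ->] := @divmod_uniq q1 r1 k.+1 1 le1 t_gt0; first by rewrite -E1.
  by move: NE; rewrite !mulSn; lia.
case: (leqP t r2) => r2t.
  have [//||-> ->] := @divmod_uniq q1 r1 q2 0 le1; first by rewrite -E1 E2; lia.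
  lia.
case: q2 E2 kq2 => // q2 E2 kq2.
have [|-> ->] := @divmod_uniq q1 r1 q2 r2.+1 le1 r2t.
  by rewrite -E1 E2 mulSn; lia.
lia.
Qed.

(** The bound for B stays strictly below that for A(N,k+1), N = v+t+1, as the passage to a cokernel
    requires. *)
Lemma pd_bound_lt_block v k : k * t <= v ->
  (maxn (pd_bound v k) (pd_bound v k.+1).+1) < pd_bound (v + t.+1) k.+1.
Proof.
move=> kv; rewrite gtn_max; apply/andP; split.
  case: k kv => [|k] kv.
    case: (@pd_boundP (v + t.+1) 1) => // [[le2 ->]|[q2 [r2 [E2 le2 kq2 lt2 ->]]]] //.
      by rewrite /pd_bound /=; lia.
    by rewrite /pd_bound /=; lia.
  case: (@pd_boundP v k.+1) => // [[le1 ->]|[q1 [r1 [E1 le1 kq1 lt1 ->]]]];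
  case: (@pd_boundP (v + t.+1) k.+2) => // [[le2 ->]|[q2 [r2 [E2 le2 kq2 lt2 ->]]]];
  rewrite ?mulSn in kv le1 le2 *; try lia.
  have [|-> ->] := @divmod_uniq q2 r2 q1.+1 r1 le2 le1; first by rewrite mulSn; lia.
  lia.
case: (@pd_boundP v k.+1) => // [[le1 ->]|[q1 [r1 [E1 le1 kq1 lt1 ->]]]];
case: (@pd_boundP (v + t.+1) k.+1) => // [[le2 ->]|[q2 [r2 [E2 le2 kq2 lt2 ->]]]];
  rewrite ?mulSn in kv le1 le2 *; try lia.
  case: (leqP q2 k.+1) => qk.
    have E : q2 = k.+1 by lia.
    move: E2 lt2; rewrite E mulSn; lia.
  lia.
have [|-> ->] := @divmod_uniq q2 r2 q1.+1 r1 le2 le1; first by rewrite mulSn; lia.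
lia.
Qed.

End PdBound.

(** * The Mayer-Vietoris induction *)

Section PathUpperBound.
Variables (K : fieldType) (n : nat).
Local Notation R := {mpoly K[n]}.
Implicit Types (m mu : 'X_{1..n}) (f g : R) (Q : 'X_{1..n} -> Prop).

Definition ideal_module Q : lmodType R := submodule (@monomial_ideal K n Q).

Definition upclosed Q := forall m m', (m <= m')%MM -> Q m -> Q m'.

Lemma upclosed_idealP Q f : upclosed Q ->
  (f \in @monomial_ideal K n Q) <-> (forall m, m \in msupp f -> Q m).
Proof.
move=> upQ; split=> [/monomial_idealP fQ m /fQ[m0 Q0 le_m]|fQ]; first exact: upQ le_m Q0.
by apply/monomial_idealP => m /fQ Qm; exists m => //; exact: lepm_refl.
Qed.

Lemma ideal_module_eq0 Q : (forall m, ~ Q m) -> forall x : ideal_module Q, x = 0.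
Proof.
move=> nQ x; apply: sub_val_inj; rewrite linear0; apply/eqP; rewrite -msupp_eq0.
have /monomial_idealP := sub_valP x.
by case: (msupp _) => // m s /(_ m (mem_head _ _))[m0 /nQ].
Qed.

Lemma pd_lt_unit_ideal Q : (forall m, Q m) -> pd_lt 1 (ideal_module Q).
Proof.
move=> allQ.
have [p pE] : exists p : {linear (R^o : lmodType R) -> ideal_module Q},
    forall x, sub_val (p x) = idfun x.
  apply: linear_factor => [|x]; first exact: sub_val_inj.
  have xQ : x \in @monomial_ideal K n Q.
    by apply/monomial_idealP => m _; exists m => //; exact: lepm_refl.
  by exists (Submodule xQ).
exists (R^o : lmodType R), (submodule (kerp p)), (@sub_val _ _ _), p; split.
- exact: projective_regular.
- by apply: kernel_exact => y; exists (sub_val y); apply: sub_val_inj; rewrite pE.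
- move=> x; apply: sub_val_inj; rewrite linear0.
  have := sub_valP x; rewrite unfold_in => /eqP/(congr1 (@sub_val _ _ _)).
  by rewrite pE linear0.
Qed.

(* The Mayer-Vietoris sequence of I3 = mu I1 + I2, in which D = I1 :&: (I2 : mu). *)
Lemma pd_lt_sum mu Q1 Q2 Q3 QD a b :
    upclosed Q1 -> upclosed Q2 -> upclosed Q3 ->
    (forall m, Q3 m <-> ((mu <= m)%MM /\ Q1 (m - mu)%MM) \/ Q2 m) ->
    (forall m, QD m <-> Q1 m /\ Q2 (mu + m)%MM) ->
    (a < b)%N \/ b = 0%N ->
    pd_lt a (ideal_module QD) -> pd_lt b (ideal_module Q1) ->
    pd_lt b (ideal_module Q2) ->
  pd_lt b (ideal_module Q3).
Proof.
move=> up1 up2 up3 Q3E QDE ab pdD pd1 pd2.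
have upD : upclosed QD.
  move=> m m' le_m /QDE[q1 q2]; apply/QDE; split; first exact: up1 le_m q1.
  by apply: up2 q2; apply/mnm_lepP => i; rewrite !mnmDE leq_add2l (mnm_lepP le_m).
have mem1 (x : ideal_module Q1) m : m \in msupp (sub_val x : R) -> Q1 m.
  by move=> mx; have /(upclosed_idealP _ up1) := sub_valP x; apply.
have mem2 (x : ideal_module Q2) m : m \in msupp (sub_val x : R) -> Q2 m.
  by move=> mx; have /(upclosed_idealP _ up2) := sub_valP x; apply.
have mem3 (x : ideal_module Q3) m : m \in msupp (sub_val x : R) -> Q3 m.
  by move=> mx; have /(upclosed_idealP _ up3) := sub_valP x; apply.
have memD (x : ideal_module QD) m : m \in msupp (sub_val x : R) -> QD m.
  by move=> mx; have /(upclosed_idealP _ upD) := sub_valP x; apply.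
have msuppXM (f : R) m : m \in msupp ('X_[mu] * f) -> exists2 m', m' \in msupp f & m = (mu + m')%MM.
  case/msuppM_le/allpairsP => [[m1 m2] /= []]; rewrite msuppX inE => /eqP-> ? ->.
  by exists m2.
have [hm hmE] : exists h : {linear (R^o : lmodType R) -> (R^o : lmodType R)},
    h =1 fun f => 'X_[mu] * (f : R).
  by apply: linear_of => c u v; rewrite mulrDr; congr (_ + _); exact: mulrCA.
have [p0 p0E] : exists p0 : {linear (ideal_module Q1 * ideal_module Q2)%type -> (R^o : lmodType R)},
    p0 =1 fun x => hm (sub_val x.1) + sub_val x.2.
  by apply: linear_of => c u v /=; rewrite !linearP scalerDr addrACA.
have [p pE] : exists p : {linear (ideal_module Q1 * ideal_module Q2)%type -> ideal_module Q3},
    forall x, sub_val (p x) = p0 x.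
  apply: linear_factor => [|x]; first exact: sub_val_inj.
  have xQ : p0 x \in @monomial_ideal K n Q3.
    apply/(upclosed_idealP _ up3) => m; rewrite p0E hmE => /msuppD_le.
    rewrite mem_cat => /orP[/msuppXM[m' /mem1 q1 ->]|/mem2 q2]; apply/Q3E; last by right.
    by left; split; [exact: lem_addr | rewrite addmC addmK].
  by exists (Submodule xQ).
have [i1 i1E] : exists i1 : {linear ideal_module QD -> ideal_module Q1},
    forall x, sub_val (i1 x) = sub_val x.
  apply: linear_factor => [|x]; first exact: sub_val_inj.
  have xQ : sub_val x \in @monomial_ideal K n Q1.
    by apply/(upclosed_idealP _ up1) => m /memD/QDE[].
  by exists (Submodule xQ).
(* With this sign, x |-> (x, - mu x) lands in the kernel of [p]. *)
have [j jE] : exists j : {linear ideal_module QD -> (R^o : lmodType R)},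
    j =1 fun x => - hm (sub_val x).
  by apply: linear_of => c u v; rewrite !linearP.
have [i2 i2E] : exists i2 : {linear ideal_module QD -> ideal_module Q2},
    forall x, sub_val (i2 x) = j x.
  apply: linear_factor => [|x]; first exact: sub_val_inj.
  have xQ : j x \in @monomial_ideal K n Q2.
    apply/(upclosed_idealP _ up2) => m; rewrite jE hmE (perm_mem (msuppN _)).
    by case/msuppXM => m' /memD/QDE[_ q2] ->.
  by exists (Submodule xQ).
have [i iE] : exists i : {linear ideal_module QD -> (ideal_module Q1 * ideal_module Q2)%type},
    i =1 fun x => (i1 x, i2 x).
  by apply: linear_of => c u v; rewrite !linearP.
apply: (@pd_lt_cokernel _ _ _ _ _ _ i p _ ab pdD (pd_lt_prod pd1 pd2)); split.
- move=> x y; rewrite !iE => -[/(congr1 (@sub_val _ _ _)) + _].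
  by rewrite !i1E => /sub_val_inj.
- move=> x; have [f1 [f2 [fE f1Q f2Q]]] : exists f1 f2 : R, [/\ (sub_val x : R) = f1 + f2,
      forall m, m \in msupp f1 -> (mu <= m)%MM /\ Q1 (m - mu)%MM &
      forall m, m \in msupp f2 -> Q2 m].
    by apply: monomial_ideal_split => m /mem3/Q3E.
  have [|g gE gQ] := @mpolyX_divide K n mu f1; first by move=> m /f1Q[].
  have g1 : g \in @monomial_ideal K n Q1.
    by apply/(upclosed_idealP _ up1) => m /gQ/f1Q[_]; rewrite addmC addmK.
  have g2 : f2 \in @monomial_ideal K n Q2 by apply/(upclosed_idealP _ up2).
  exists (Submodule g1, Submodule g2); apply: sub_val_inj.
  by rewrite pE p0E hmE /= -gE fE.
- move=> [x y]; split=> [pxy|[z <-]]; last first.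
    by apply: sub_val_inj; rewrite linear0 pE p0E iE /= i1E i2E jE subrr.
  have E : (sub_val y : R) = - ('X_[mu] * (sub_val x : R)).
    apply/eqP; rewrite -addr_eq0 addrC; apply/eqP.
    by have := congr1 (@sub_val _ _ _) pxy; rewrite pE p0E hmE linear0.
  have xD : sub_val x \in @monomial_ideal K n QD.
    apply/(upclosed_idealP _ upD) => m mx; apply/QDE; split; first exact: mem1 mx.
    apply: (mem2 y); rewrite E (perm_mem (msuppN _)) mcoeff_msupp mulrC mcoeffMX.
    by rewrite -mcoeff_msupp.
  exists (Submodule xD); rewrite iE; congr pair; apply: sub_val_inj.
    by rewrite i1E.
  by rewrite i2E jE hmE -E.
Qed.

Variable t : nat.
Hypothesis t_gt0 : (0 < t)%N.

Definition has_run N k m : Prop := run_matching t (supp m) N k.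

(** The monomials of the ideal B of the header, with v = N and k+1 in place of k. *)
Definition has_run_or N k m : Prop := has_run N k.+1 m \/ supp m N /\ has_run N k m.

Lemma has_run_up N k : upclosed (has_run N k).
Proof.
by move=> m m' le_m; apply: run_matching_mono (leqnn N) => j _; apply: supp_le.
Qed.

Lemma has_run_or_up N k : upclosed (has_run_or N k).
Proof.
move=> m m' le_m [H|[mN H]]; [left|right]; first exact: has_run_up le_m H.
by split; [exact: supp_le mN | exact: has_run_up le_m H].
Qed.

Lemma has_runD N k l m : (forall i, i \in l -> N <= i)%N ->
  has_run N k (mlist n l + m)%MM <-> has_run N k m.
Proof.
move=> lN; split; last by apply: has_run_up; exact: lem_addl.
apply: run_matching_mono (leqnn N) => j jN.
rewrite suppD supp_mlist => /orP[/andP[_ /lN]|//]; lia.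
Qed.

(** The second Mayer-Vietoris sequence, with mu = x_N: since x_N does not affect runs below N, the
    intersection term is A(N,k+1) itself. *)
Lemma pd_lt_has_run_or N k a b : (N < n)%N -> (a < b)%N ->
    pd_lt a (ideal_module (has_run N k.+1)) -> pd_lt b (ideal_module (has_run N k)) ->
  pd_lt b (ideal_module (has_run_or N k)).
Proof.
move=> lt_Nn lt_ab pda pdb.
apply: (@pd_lt_sum (mlist n [:: N]) (has_run N k) (has_run N k.+1) _ (has_run N k.+1) a b).
- exact: has_run_up.
- exact: has_run_up.
- exact: has_run_or_up.
- have leN i : i \in [:: N] -> (N <= i)%N by rewrite inE => /eqP->.
  have le_N m : (mlist n [:: N] <= m)%MM = supp m N.
    apply/idP/idP => [|mN]; last by apply: mlist_le => // i; rewrite inE => /eqP-> _.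
    move/supp_le; apply; by rewrite supp_mlist lt_Nn mem_head.
  move=> m; rewrite le_N; split=> [[H|[mN H]]|[[mN H]|H]]; [by right| |right|by left].
    left; split=> //; apply/(has_runD _ _ leN).
    by rewrite addmC submK // le_N.
  split=> //; rewrite -[m](@submK _ (mlist n [:: N])) ?le_N // addmC.
  exact/(has_runD _ _ leN).
- have leN i : i \in [:: N] -> (N <= i)%N by rewrite inE => /eqP->.
  move=> m; split=> [H|[_ /(has_runD _ _ leN)]//]; split; last exact/(has_runD _ _ leN).
  exact: run_matching_anti H.
- by left.
- exact: pda.
- exact: pdb.
- by apply: pd_ltW pda; apply: ltnW.
Qed.

Lemma has_run_last N k m : (0 < N)%N -> (N <= n)%N ->
  has_run N k.+1 m <->
    ((t <= N)%N /\ (mlist n (iota (N - t) t) <= m)%MM /\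
      has_run (N - t) k (m - mlist n (iota (N - t) t))%MM) \/ has_run N.-1 k.+1 m.
Proof.
move=> N_gt0 le_Nn.
have leN i : i \in iota (N - t) t -> (N - t <= i)%N by rewrite mem_iota => /andP[].
have le_N : (t <= N)%N -> (mlist n (iota (N - t) t) <= m)%MM <->
    forall j, (N - t <= j < N)%N -> supp m j.
  move=> le_tN; split=> [le_m j jN|mN].
    apply: (supp_le le_m); rewrite supp_mlist mem_iota; lia.
  apply: mlist_le; first exact: iota_uniq.
  by move=> j; rewrite mem_iota => jN _; apply: mN; lia.
rewrite /has_run run_matching_last; split=> [[H|[le_tN H1 H2]]|[[le_tN [H1 H2]]|H]].
- by right.
- have le_m : (mlist n (iota (N - t) t) <= m)%MM by apply/le_N.
  left; do 2!split=> //; apply/(has_runD _ _ leN).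
  by rewrite addmC submK.
- right; split=> //; first exact/le_N.
  rewrite -[m](submK H1) addmC.
  exact/(has_runD _ _ leN).
- by left.
Qed.

Lemma pd_lt_has_run N k : (N <= n)%N -> pd_lt (pd_bound t N k) (ideal_module (has_run N k)).
Proof.
elim/ltn_ind: N k => N IHN [|k] le_Nn; first exact: pd_lt_unit_ideal.
case: (ltnP N (k.+1 * t)) => [lt_N|ge_N].
  apply: pd_lt_zero; apply: ideal_module_eq0 => m /run_matching_leq; lia.
have N_gt0 : (0 < N)%N by lia.
have le_tN : (t <= N)%N by move: ge_N; rewrite mulSn; lia.
have leN i : i \in iota (N - t) t -> (N - t <= i)%N by rewrite mem_iota => /andP[].
pose QD m := has_run (N - t) k m /\ has_run N.-1 k.+1 (mlist n (iota (N - t) t) + m)%MM.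
have b_gt0 := @pd_bound_gt0 t t_gt0 N k.+1 ge_N.
have pdD : exists2 a, (a < pd_bound t N k.+1)%N & pd_lt a (ideal_module QD).
  case: (ltnP t N) => [lt_tN|ge_tN]; last first.
    exists 0%N => //; apply: ideal_module_eq0 => m [_ /run_matching_leq].
    by rewrite mulSn; lia.
  have [v vE] : exists v, N = (v + t.+1)%N by exists (N - t.+1)%N; lia.
  have QDE : QD = has_run_or v k.
    apply/funext => m; apply/propext; rewrite /QD vE.
    have -> : (v + t.+1 - t = v.+1)%N by lia.
    have -> : (v + t.+1).-1 = (v + t)%N by lia.
    have lev N' i : (N' <= v.+1)%N -> i \in iota v.+1 t -> (N' <= i)%N by rewrite mem_iota; lia.
    split=> [[H1 [i [le_i Pi H2]]]|].
      have {}H2 : has_run i k m.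
        by apply/(@has_runD i k (iota v.+1 t)) => // j; apply: lev; lia.
      (* The last run starts at i <= v, so it lies below v or contains v; the variables of mu only
         supply vertices beyond v. *)
      case: (leqP (i + t) v) => iv.
        left; exists i; split=> // j ij; have := Pi j ij; rewrite suppD supp_mlist mem_iota; lia.
      right; split; last by apply: (run_matching_mono _ _ H2) => //; lia.
      have := Pi v; rewrite suppD supp_mlist mem_iota ltnn andbF /=; apply; lia.
    case=> [H|[mv H]].
      split; first by apply: (@run_matching_mono t _ _ v _ k) (run_matching_anti (leqnSn k) H).
      apply: has_run_up (lem_addl _ _) _.
      by apply: (run_matching_mono _ _ H) => //; lia.
    split; first by apply: (run_matching_mono _ _ H).
    (* The vertex v from m and the first t-1 vertices of mu form the extra run. *)
    exists v; split=> // [j jv|]; last first.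
      by apply: has_run_up (lem_addl _ _) _.
    rewrite suppD supp_mlist mem_iota; have [->|jv'] := eqVneq j v; first by rewrite mv orbT.
    lia.
  rewrite QDE; case: (leqP (k * t) v) => [ge_v|lt_v]; last first.
    exists 0%N => //; apply: ideal_module_eq0 => m [/run_matching_leq|[_ /run_matching_leq]];
      rewrite ?mulSn; lia.
  (* For B both terms of its sequence count, and the bound must also exceed that of A(v,k+1). *)
  exists (maxn (pd_bound t v k) (pd_bound t v k.+1).+1).
    by rewrite vE pd_bound_lt_block.
  apply: (@pd_lt_has_run_or v k (pd_bound t v k.+1)); first lia.
  - by rewrite leq_max ltnSn orbT.
  - by apply: IHN; lia.
  - by apply: pd_ltW (IHN v _ k _); rewrite ?leq_maxl //; lia.
have [a lt_ab pda] := pdD.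
apply: (@pd_lt_sum (mlist n (iota (N - t) t)) (has_run (N - t) k) (has_run N.-1 k.+1) _ QD a).
- exact: has_run_up.
- exact: has_run_up.
- exact: has_run_up.
- move=> m; rewrite has_run_last //; split=> [[[_ ?]|?]|[?|?]]; by [left|right|left; split].
- by [].
- by left.
- exact: pda.
- by apply: pd_ltW (IHN (N - t)%N _ k _); rewrite ?pd_bound_le_run //; lia.
- by apply: pd_ltW (IHN N.-1 _ k.+1 _); rewrite ?pd_bound_le_prev //; lia.
Qed.

Lemma path_upper_bound k p : pd_bound t n k = p ->
  has_projective_resolution
    (quotient_module (squarefree_power (path_ideal K n t) k)) p.
Proof.
move=> <-; apply: pd_lt_resolution.
have [p1 p1E] : exists h : {linear (R^o : lmodType R) ->
    quotient_module (squarefree_power (path_ideal K n t) k)}, h =1 @quot_proj _ _ _.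
  by apply: linear_of => a x y; rewrite quot_projD -quot_scale_proj.
have sp1 : surjective p1.
  by move=> x; have [v vE] := quot_projP x; exists v; rewrite p1E.
exists (R^o : lmodType R), (ideal_module (has_run n k)), (@sub_val _ _ _), p1; split.
- exact: projective_regular.
- split=> // [|x]; first exact: sub_val_inj.
  have -> : p1 x = 0 <-> x \in squarefree_power (path_ideal K n t) k.
    by rewrite -(linear0 p1) !p1E quot_proj_eq subr0.
  rewrite squarefree_powerE //; split=> [xI|[y <-]]; last exact: (sub_valP y).
  by exists (Submodule xI).
- exact: pd_lt_has_run.
Qed.

End PathUpperBound.

(** * The theorem *)

Local Close Scope ring_scope.

Section Witnesses.
Variable t : nat.
Hypothesis t_gt0 : 0 < t.

Definition has_witness n k p := exists U ps b C, witness t n k p U ps b C.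

Lemma has_witness_pairs n k p r : has_witness n k p ->
  has_witness (n + r * t.+1) (k + r) (p + r).
Proof.
move=> w; elim: r => [|r IHr]; first by rewrite mul0n !addn0.
have [U [ps [b [C wr]]]] := IHr; have := witness_add_pair t_gt0 wr.
have -> : (n + r * t.+1 + t).+1 = n + r.+1 * t.+1 by rewrite mulSn; lia.
by rewrite !addnS => wr'; do 4!eexists; exact: wr'.
Qed.

Lemma witness_bases n p U b C r : witness t n 1 p U [::] b C ->
  exists U' C', witness t (n + r * t.+1) 1 (p + 2 * r) U' [::] b C'.
Proof.
move=> w; elim: r => [|r [U' [C' /(witness_add_base t_gt0)]]].
  by exists U, C; rewrite mul0n muln0 !addn0.
have -> : (n + r * t.+1 + t).+1 = n + r.+1 * t.+1 by rewrite mulSn; lia.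
by rewrite (_ : (_ + _).+2 = p + 2 * r.+1) => [w'|]; [do 2!eexists; exact: w' | lia].
Qed.

(** With r = n - kt, take k-r tiled runs and r blocks with paired ends. For r = k nothing is left to
    tile, so one block starts instead, followed by k-1 paired ones. *)
Lemma has_witness_small n k : 0 < k -> k * t <= n <= k * t.+1 ->
  has_witness n k (n - k * t).+1.
Proof.
move=> k_gt0 /andP[ge_n le_n]; pose r := n - k * t.
have le_rk : r <= k by move: le_n; rewrite mulnS /r; lia.
have nE : n = k * t + r by rewrite /r; lia.
have [lt_rk|ge_rk] := ltnP r k.
  have w : has_witness ((k - r) * t) (k - r) 1.
    by do 4!eexists; apply: (witness_runs t_gt0); lia.
  have := has_witness_pairs r w; rewrite subnK // add1n -/r.
  by rewrite (_ : _ + _ = n) // nE mulnBl mulnS; have := leq_mul2r t r k; lia.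
have w : has_witness t.+1 1 2.
  by do 4!eexists; apply: (@witness_block t t_gt0 0).
have := has_witness_pairs k.-1 w.
have -> : t.+1 + k.-1 * t.+1 = n.
  by rewrite -mulSn prednK // mulnS nE; lia.
rewrite add1n prednK // (_ : 2 + k.-1 = (n - k * t).+1) //; lia.
Qed.

(** For d = t start from a single run and add q-k+1 base blocks; for d < t start from a block
    shifted by d and add q-k of them. In both cases k-1 paired blocks follow. *)
Lemma has_witness_large q d k : 0 < k -> k <= q -> d <= t ->
  has_witness (q * t.+1 + d) k ((2 * q - k).+1 + (d == t)).
Proof.
move=> k_gt0 le_kq; rewrite leq_eqVlt => /predU1P[->|lt_dt].
  have w := @witness_runs t t_gt0 1 isT; rewrite mul1n in w.
  have [U' [C' w']] := witness_bases (q - k).+1 w.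
  have w'' : has_witness (t + (q - k).+1 * t.+1) 1 (1 + 2 * (q - k).+1) by do 4!eexists; exact: w'.
  have := has_witness_pairs k.-1 w''; rewrite eqxx add1n prednK //.
  rewrite -addnA -mulnDl (_ : (q - k).+1 + k.-1 = q); last lia.
  by rewrite addnC (_ : 1 + 2 * (q - k).+1 + k.-1 = (2 * q - k).+1 + 1) //; lia.
have w := @witness_block t t_gt0 d lt_dt.
have [U' [C' w']] := witness_bases (q - k) w.
have w'' : has_witness ((d + t).+1 + (q - k) * t.+1) 1 (2 + 2 * (q - k)) by do 4!eexists; exact: w'.
have := has_witness_pairs k.-1 w''; rewrite (ltn_eqF lt_dt) addn0 add1n prednK //.
rewrite -addnA -mulnDl -addnS -addnA -mulSn (_ : (q - k + k.-1).+1 = q); last lia.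
by rewrite addnC (_ : 2 + 2 * (q - k) + k.-1 = (2 * q - k).+1) //; lia.
Qed.

End Witnesses.

Theorem theorem0p1 (K : fieldType) (t n k : nat)
    (ht1 : 1 <= t) (htn : t <= n) (hk1 : 1 <= k)
    (hk : k <= matching_number (path_complex n t)) :
  let M : lmodType {mpoly K[n]} :=
    quotient_module (squarefree_power (path_ideal K n t) k) in
  [/\ k * t <= n <= k * (t + 1) ->
        projective_dimension_is M (n - k * t + 1),
      forall d : nat, 0 <= d <= t - 1 -> n = d %[mod t + 1] ->
        k * (t + 1) < n ->
        projective_dimension_is M (2 * (n - d) %/ (t + 1) - k + 1)
    & n = t %[mod t + 1] -> k * (t + 1) < n ->
        projective_dimension_is M (2 * (n + 1) %/ (t + 1) - k)].
Proof.
move=> M; rewrite !addn1.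
(* A witness of degree p bounds the dimension below and [pd_bound] bounds it above. *)
have pd p : has_witness t n k p -> pd_bound t n k = p -> projective_dimension_is M p.
  move=> [U [ps [b [C w]]]] pE; split; first exact: path_upper_bound pE.
  by move=> l; apply: path_lower_bound w.
have large q d : n = q * t.+1 + d -> d <= t -> k * t.+1 < n ->
    projective_dimension_is M ((2 * q - k).+1 + (d == t)) /\ k <= q.
  move=> nE le_dt lt_n; rewrite nE in lt_n.
  have [le_kq bE] := pd_bound_large hk1 le_dt lt_n.
  by split=> //; apply: pd; rewrite nE //; apply: has_witness_large.
have modE d : d <= t -> n = d %[mod t.+1] -> n = n %/ t.+1 * t.+1 + d.
  by move=> le_dt nd; rewrite {1}(divn_eq n t.+1) nd (modn_small (m := d)).
split=> [/[dup] hn /andP[le1 le2]|d /andP[_ d_le] nd lt_n|nt lt_n].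
- apply: pd; first exact: has_witness_small.
  rewrite pd_bound_small //; move: le1 le2; rewrite mulnS; lia.
- have d_lt : d < t by rewrite -(prednK ht1) ltnS -subn1.
  have nE := modE d (ltnW d_lt) nd; have [] := large _ _ nE (ltnW d_lt) lt_n.
  rewrite (ltn_eqF d_lt) addn0 => + _.
  by rewrite [X in X - d]nE addnK mulnA mulnK // addn1.
- have nE := modE t (leqnn t) nt; have [] := large _ _ nE (leqnn t) lt_n.
  rewrite eqxx => + le_kq.
  (* Here n+1 is (q+1)(t+1) with q the quotient of n, and k <= q keeps the subtraction exact. *)
  rewrite [X in 2 * X.+1]nE -addnS -mulSnr mulnA mulnK //.
  by rewrite (_ : 2 * (n %/ t.+1).+1 - k = (2 * (n %/ t.+1) - k).+1 + 1) //; lia.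
Qed.
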